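(* For every ordinal $\gamma$ and every natural number $m$: if $\bigcup F^m_\gamma=\gamma$, then there exist an ordinal $\alpha$ and a natural number $n$ such that $\bigcup F^{m+1}_\alpha=\alpha$ and $\gamma=\alpha+\omega^{m+1}\cdot n$.
   Context: We work in the following first-order theory with one binary relation $\in$; all objects are called sets. Definitions: $s$ is an individual if $s\in s$. $s=t$ means $\forall u(u\in s\leftrightarrow u\in t)$. Axioms: (equality) $\forall s\forall t(s=t\rightarrow\forall u(s\in u\leftrightarrow t\in u))$; (individuals) $\forall s(s\in s\rightarrow\forall u(u\in s\rightarrow u=s))$; (pairs) $\forall s\forall t\exists v\forall u(u\in v\leftrightarrow(u=s\vee u=t))$, $v$ denoted $\{s,t\}$, and $\{s\}=\{s,s\}$; (regularity) $\forall s\exists v\,[(v\in s\wedge v\in v\wedge\forall u(u\in s\rightarrow u\in u))\vee(v\in s\wedge v\notin v\wedge\forall u(u\in v\wedge u\notin u\rightarrow u\notin s))]$; (union) $\forall s\exists v\forall u(u\in v\leftrightarrow\exists w(w\in s\wedge u\in w))$, $v$ denoted $\bigcup s$, and $s\cup t=\bigcup\{s,t\}$; (power) $\forall s\exists v\forall u(u\in v\leftrightarrow\forall w(w\in u\rightarrow w\in s))$; (separation) for every formula $\Phi(u)$ with $u$ free: $\forall s(\exists u(u\in s\wedge\Phi(u))\rightarrow\exists v\forall u(u\in v\leftrightarrow u\in s\wedge\Phi(u)))$; and the axiom of infinity stated below. (In particular every set has a member; there is no empty set.) $s\subseteq t$ means $\forall u(u\in s\rightarrow u\in t)$. $s$ is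 transitive if $\forall u(u\in s\rightarrow u\subseteq s)$; in the phrase ''transitive set'' the set is not an individual, whereas ''transitive members'' may be individuals. A pair of different individuals $o\neq e$ is fixed and $0=\{o,e\}$. $s$ is a natural number if $s$ is a transitive set with transitive members and $s\notin 0\wedge\forall u(u\in s\cup\{s\}\rightarrow u\in 0\cup\{0\}\vee\bigcup u\in u)$. The letters $l,m,n$ denote natural numbers; the first natural number is $0$, $n+1=n\cup\{n\}$, $1=0+1$. $\beta$ is an ordinal if $\beta$ is a transitive set with transitive members and $\beta\notin 0\wedge\forall u(u\in\beta\wedge u\in u\rightarrow u\in 0)$. Greek letters denote ordinals. $\beta+0=\beta$, $\beta+(n+1)=(\beta+n)\cup\{\beta+n\}$. For an ordinal $\gamma$, the sets $F^m_\gamma$ are defined by recursion on $m$: $F^0_\gamma=\gamma$ and $\forall u(u\in F^{m+1}_\gamma\leftrightarrow u\in F^m_\gamma\wedge\bigcup F^m_u=u)$; the same clauses are used for $\gamma\in\{o,e\}$ (giving $F^m_o=o$, $F^m_e=e$). An ordinal $\alpha$ is a first $\omega^m$-number if $\bigcup F^m_\alpha=\alpha$. The terms $\alpha+\omega^m$ and $\alpha+\omega^m\cdot n$ are introduced by recursion (each clause applies when the terms on its right-hand side are defined): $\omega^0=1$, so $\alpha+\omega^0=\alpha\cup\{\alpha\}$ and $\alpha+\omega^0\cdot n=\alpha+n$. Axiom of infinity: $\forall\alpha\forall m(\bigcup F^m_\alpha=\alpha\rightarrow\exists\gamma\forall u(u\in\gamma\leftrightarrow\exists n(u\in\alpha+\omega^m\cdot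 n)))$, and this $\gamma$ is denoted $\alpha+\omega^{m+1}$. If $\alpha$ is a first $\omega^m$-number, then $\alpha+\omega^{m+1}\cdot 0=\alpha$ and $\alpha+\omega^{m+1}\cdot(n+1)=(\alpha+\omega^{m+1}\cdot n)+\omega^{m+1}$. *)

(* Defs.v *)
Set Implicit Arguments.
Unset Strict Implicit.

(* De Bruijn indices: index 0 is bound by the innermost quantifier.  Equality
   is not a primitive of the language. *)
Inductive formula : Type :=
| FMem : nat -> nat -> formula
| FNot : formula -> formula
| FAnd : formula -> formula -> formula
| FOr  : formula -> formula -> formula
| FImp : formula -> formula -> formula
| FAll : formula -> formula
| FEx  : formula -> formula.

(* [at_o] and [at_e] are the two fixed individuals; they are not symbols of the
   language, formulas reach them as parameters. *)
Record structure : Type := Structure {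
  carrier :> Type;
  mem : carrier -> carrier -> Prop;
  at_o : carrier;
  at_e : carrier
}.

Declare Scope atoms_scope.
Delimit Scope atoms_scope with atoms.
Local Open Scope atoms_scope.

Notation "x ∈ y" := (mem x y) (at level 70, no associativity) : atoms_scope.
Notation "x ∉ y" := (~ mem x y) (at level 70, no associativity) : atoms_scope.

Definition scons (A : Type) (a : A) (r : nat -> A) (i : nat) : A :=
  match i with 0 => a | S j => r j end.

Section Definitions.

Context {M : structure}.

Fixpoint sat (r : nat -> M) (p : formula) : Prop :=
  match p with
  | FMem i j => r i ∈ r j
  | FNot p1 => ~ sat r p1
  | FAnd p1 p2 => sat r p1 /\ sat r p2
  | FOr p1 p2 => sat r p1 \/ sat r p2
  | FImp p1 p2 => sat r p1 -> sat r p2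
  | FAll p1 => forall a : M, sat (scons a r) p1
  | FEx p1 => exists a : M, sat (scons a r) p1
  end.

(* The equality of the theory is having the same members, which need not be
   Leibniz equality on the carrier.  A term is rendered by the predicate saying
   that a given set is its value. *)

Definition eqs (s t : M) : Prop := forall u : M, u ∈ s <-> u ∈ t.

Definition individual (s : M) : Prop := s ∈ s.

Definition subs (s t : M) : Prop := forall u : M, u ∈ s -> u ∈ t.

Definition is_pair (s t v : M) : Prop := forall u : M, u ∈ v <-> eqs u s \/ eqs u t.

Definition is_sing (s v : M) : Prop := is_pair s s v.

Definition is_bigcup (s v : M) : Prop :=
  forall u : M, u ∈ v <-> exists w : M, w ∈ s /\ u ∈ w.

Definition is_cup (s t v : M) : Prop := exists p : M, is_pair s t p /\ is_bigcup p v.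

(* v = s ∪ {s}; this is also the term s + 1 *)
Definition is_succ (s v : M) : Prop := exists q : M, is_sing s q /\ is_cup s q v.

(* v = 0 = {o,e} *)
Definition is_zero (v : M) : Prop := is_pair (at_o M) (at_e M) v.

Definition in_zero (u : M) : Prop := exists z : M, is_zero z /\ u ∈ z.

(* u ∈ 0 ∪ {0} *)
Definition in_succ_zero (u : M) : Prop :=
  exists z z1 : M, is_zero z /\ is_succ z z1 /\ u ∈ z1.

Definition transitive (s : M) : Prop := forall u : M, u ∈ s -> subs u s.

Definition transitive_set_with_transitive_members (s : M) : Prop :=
  ~ individual s /\ transitive s /\ (forall u : M, u ∈ s -> transitive u).

Definition natural (s : M) : Prop :=
  transitive_set_with_transitive_members s /\
  ~ in_zero s /\
  (forall s1 u : M, is_succ s s1 -> u ∈ s1 ->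
     in_succ_zero u \/ exists v : M, is_bigcup u v /\ v ∈ u).

Definition ordinal (b : M) : Prop :=
  transitive_set_with_transitive_members b /\
  ~ in_zero b /\
  (forall u : M, u ∈ b /\ u ∈ u -> in_zero u).

(* Natural numbers are those of the structure, so a recursion has to be carried
   out inside it: a value is certified by a set S of (Kuratowski) tuples each of
   which is justified, by one of the recursion clauses, from other tuples of
   S. *)

Definition is_opair (a b p : M) : Prop :=
  exists q r : M, is_sing a q /\ is_pair a b r /\ is_pair q r p.

(* ((a,b),c) ∈ S *)
Definition in3 (S a b c : M) : Prop :=
  exists p q : M, is_opair a b p /\ is_opair p c q /\ q ∈ S.

(* (((a,b),c),d) ∈ S *)
Definition in4 (S a b c d : M) : Prop :=
  exists p q r : M, is_opair a b p /\ is_opair p c q /\ is_opair q d r /\ r ∈ S.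

(* (m,u,x) in S stands for x = F^m_u. *)
Definition F_computation (S : M) : Prop :=
  forall m u x : M, in3 S m u x ->
    natural m /\ (ordinal u \/ in_zero u) /\
    ((is_zero m /\ eqs x u) \/
     (exists k y : M, natural k /\ is_succ k m /\ in3 S k u y /\
        (forall v : M, v ∈ y -> exists z : M, in3 S k v z) /\
        (forall v : M, v ∈ x <->
           v ∈ y /\ exists z : M, in3 S k v z /\ is_bigcup z v))).

(* x = F^m_u *)
Definition is_F (m u x : M) : Prop := exists S : M, F_computation S /\ in3 S m u x.

(* ⋃F^m_u = u *)
Definition bigcup_F_eq (m u : M) : Prop := exists x : M, is_F m u x /\ is_bigcup x u.

Definition first_omega_number (m a : M) : Prop := ordinal a /\ bigcup_F_eq m a.

(* y = a + ω^m, where the terms a + ω^l·i needed when m = l+1 are read off from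
   S, a tuple (l,a,i,x) standing for x = a + ω^l·i.  The requirement on all i is
   that these terms are defined. *)
Definition omega_step (S m a y : M) : Prop :=
  (is_zero m /\ is_succ a y) \/
  (exists l : M, natural l /\ is_succ l m /\ first_omega_number l a /\
     (forall i : M, natural i -> exists x : M, in4 S l a i x) /\
     (forall u : M, u ∈ y <->
        exists i x : M, natural i /\ in4 S l a i x /\ u ∈ x)).

(* For m = 0 the two clauses are a + 0 = a and a + (k+1) = (a+k) ∪ {a+k}. *)
Definition omega_computation (S : M) : Prop :=
  forall m a n y : M, in4 S m a n y ->
    natural m /\ ordinal a /\ natural n /\
    (is_zero m \/
     exists l : M, natural l /\ is_succ l m /\ first_omega_number l a) /\
    ((is_zero n /\ eqs y a) \/
     (exists k z : M, natural k /\ is_succ k n /\ in4 S m a k z /\ omega_step S m z y)).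

(* y = a + ω^m·n *)
Definition is_omega_mul (m a n y : M) : Prop :=
  exists S : M, omega_computation S /\ in4 S m a n y.

End Definitions.

Record is_model (M : structure) : Prop := IsModel {
  ax_equality : forall s t : M, eqs s t -> forall u : M, s ∈ u <-> t ∈ u;
  ax_individuals : forall s : M, s ∈ s -> forall u : M, u ∈ s -> eqs u s;
  ax_pairs : forall s t : M, exists v : M, is_pair s t v;
  ax_regularity : forall s : M, exists v : M,
    (v ∈ s /\ v ∈ v /\ (forall u : M, u ∈ s -> u ∈ u)) \/
    (v ∈ s /\ v ∉ v /\ (forall u : M, u ∈ v /\ u ∉ u -> u ∉ s));
  ax_union : forall s : M, exists v : M, is_bigcup s v;
  ax_power : forall s : M, exists v : M, forall u : M,
    u ∈ v <-> (forall w : M, w ∈ u -> w ∈ s);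
  (* the variable u of Φ(u) has index 0; r supplies the parameters *)
  ax_separation : forall (Phi : formula) (r : nat -> M) (s : M),
    (exists u : M, u ∈ s /\ sat (scons u r) Phi) ->
    exists v : M, forall u : M, u ∈ v <-> u ∈ s /\ sat (scons u r) Phi;
  ax_o : individual (at_o M);
  ax_e : individual (at_e M);
  ax_o_neq_e : ~ eqs (at_o M) (at_e M);
  ax_infinity : forall a m : M, ordinal a -> natural m -> bigcup_F_eq m a ->
    exists g : M, forall u : M,
      u ∈ g <-> exists n : M, natural n /\ exists y : M, is_omega_mul m a n y /\ u ∈ y
}.

(* Main.v *)
(* Quotienting by having the same members, one may assume that equality of sets
   is Leibniz equality.  Then ⋃F^m_u = u unfolds to: u is the union of those of
   its members v for which ⋃F^l_v = v, where m = l + 1, or of all its members if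
   m = 0.

   The theorem follows by induction on γ.  If ⋃F^{m+1}_γ ≠ γ, the first
   ω^m-numbers below γ have a largest one δ, so γ is the next first ω^m-number
   after δ, which is δ + ω^{m+1}, as one shows by induction on m.  The computation
   sets witnessing this are separated from sets of tuples built over γ, as γ > 0
   contains every natural number; so the axiom of infinity is not called for, nor
   is replacement, which the theory lacks.  Separation applies to formulas only,
   and so do the inductions that rest on it. *)
From Stdlib Require Import Classical ClassicalEpsilon PropExtensionality FunctionalExtensionality ProofIrrelevance PeanoNat Lia.
Require Import Defs.
Local Open Scope atoms_scope.
Set Implicit Arguments.
Unset Strict Implicit.


(** A set of tuples need not remain a computation when tuples are added: the recursion clauses ask
    which values occur anywhere in the set, so a new tuple can spoil the justification of an old
    one. The remedy is uniqueness of certified values, proved across different computations; it is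
    what allows computations to be united and cut down. As there is no empty set, every use of
    separation has to be fed a witness. For the sets F^m_u the individuals o and e supply it: they
    lie in every ordinal and satisfy F^m_a = a. The price is a separate case for them whenever the
    members of an ordinal are examined. The quotient is realised by chosen representatives. The map
    onto them preserves and reflects membership, so the axioms and every notion in the statement
    pass along it in both directions. Definability is a semantic property of predicates, closed
    under connectives, quantifiers and substitution of variables or parameters, so that formulas
    never have to be written out. *)

Lemma and_congr (A A' B B' : Prop) : (A <-> A') -> (B <-> B') -> (A /\ B <-> A' /\ B').
Proof. tauto. Qed.

Lemma or_congr (A A' B B' : Prop) : (A <-> A') -> (B <-> B') -> (A \/ B <-> A' \/ B').
Proof. tauto. Qed.

Lemma imp_congr (A A' B B' : Prop) : (A <-> A') -> (B <-> B') -> ((A -> B) <-> (A' -> B')).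
Proof. tauto. Qed.

Lemma iff_congr (A A' B B' : Prop) : (A <-> A') -> (B <-> B') -> ((A <-> B) <-> (A' <-> B')).
Proof. tauto. Qed.

Lemma sat_ext (M : structure) (p : formula) :
  forall r s : nat -> M, (forall i, r i = s i) -> sat r p <-> sat s p.
Proof.
  induction p; intros r s H; simpl.
  - now rewrite !H.
  - now apply not_iff_compat, IHp.
  - now apply and_congr; [apply IHp1|apply IHp2].
  - now apply or_congr; [apply IHp1|apply IHp2].
  - now apply imp_congr; [apply IHp1|apply IHp2].
  - split; intros K a; [apply (IHp (scons a r))|apply (IHp _ (scons a s))]; auto;
      now intros [|i]; simpl.
  - split; intros [a K]; exists a; [apply (IHp (scons a r))|apply (IHp _ (scons a s))]; auto;
      now intros [|i]; simpl.
Qed.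

(** * Invariance under surjections preserving membership *)

Section Transfer.

Context (M N : structure) (f : M -> N).
Context (f_surj : forall y, exists x, f x = y).
Context (f_mem : forall x y, x ∈ y <-> f x ∈ f y).
Context (f_o : f (at_o M) = at_o N) (f_e : f (at_e M) = at_e N).

Lemma transfer_all (P : M -> Prop) (Q : N -> Prop) :
  (forall x, P x <-> Q (f x)) -> (forall x, P x) <-> (forall y, Q y).
Proof.
  intros H; split; intros K y.
  - destruct (f_surj y) as [x <-]; apply H, K.
  - apply H, K.
Qed.

Lemma transfer_ex (P : M -> Prop) (Q : N -> Prop) :
  (forall x, P x <-> Q (f x)) -> (exists x, P x) <-> (exists y, Q y).
Proof.
  intros H; split; intros [y K].
  - exists (f y); apply H, K.
  - destruct (f_surj y) as [x <-]; exists x; apply H, K.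
Qed.

Create HintDb transfer.

(** Every notion is built from membership and the two atoms by connectives and quantifiers;
    membership is preserved both ways, and surjectivity takes care of the quantifiers. *)
Ltac transfer :=
  intros; rewrite <- ?f_o, <- ?f_e;
  repeat first
    [ apply f_mem
    | solve [auto with transfer nocore]
    | match goal with
      | |- (forall x : carrier M, _) <-> _ => apply transfer_all; intros ?
      | |- (exists x : carrier M, _) <-> _ => apply transfer_ex; intros ?
      | |- (_ /\ _) <-> _ => apply and_congr
      | |- (_ \/ _) <-> _ => apply or_congr
      | |- (_ <-> _) <-> _ => apply iff_congr
      | |- (~ _) <-> _ => apply not_iff_compat
      | |- (_ -> _) <-> _ => apply imp_congr
      end ].

Lemma eqs_transfer x y : eqs x y <-> eqs (f x) (f y).
Proof. unfold eqs; transfer. Qed.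
Hint Resolve eqs_transfer : transfer.

Lemma is_pair_transfer x y z : is_pair x y z <-> is_pair (f x) (f y) (f z).
Proof. unfold is_pair; transfer. Qed.
Hint Resolve is_pair_transfer : transfer.

Lemma is_bigcup_transfer x y : is_bigcup x y <-> is_bigcup (f x) (f y).
Proof. unfold is_bigcup; transfer. Qed.
Hint Resolve is_bigcup_transfer : transfer.

Lemma is_succ_transfer x y : is_succ x y <-> is_succ (f x) (f y).
Proof. unfold is_succ, is_sing, is_cup; transfer. Qed.
Hint Resolve is_succ_transfer : transfer.

Lemma is_zero_transfer x : is_zero x <-> is_zero (f x).
Proof. unfold is_zero; transfer. Qed.
Hint Resolve is_zero_transfer : transfer.

Lemma in_zero_transfer x : in_zero x <-> in_zero (f x).
Proof. unfold in_zero; transfer. Qed.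
Hint Resolve in_zero_transfer : transfer.

Lemma in_succ_zero_transfer x : in_succ_zero x <-> in_succ_zero (f x).
Proof. unfold in_succ_zero; transfer. Qed.
Hint Resolve in_succ_zero_transfer : transfer.

Lemma transitive_members_transfer x :
  transitive_set_with_transitive_members x <-> transitive_set_with_transitive_members (f x).
Proof. unfold transitive_set_with_transitive_members, individual, transitive, subs; transfer. Qed.
Hint Resolve transitive_members_transfer : transfer.

Lemma natural_transfer x : natural x <-> natural (f x).
Proof. unfold natural; transfer. Qed.
Hint Resolve natural_transfer : transfer.

Lemma ordinal_transfer x : ordinal x <-> ordinal (f x).
Proof. unfold ordinal; transfer. Qed.
Hint Resolve ordinal_transfer : transfer.

Lemma in3_transfer s x y z : in3 s x y z <-> in3 (f s) (f x) (f y) (f z).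
Proof. unfold in3, is_opair, is_sing; transfer. Qed.
Hint Resolve in3_transfer : transfer.

Lemma in4_transfer s x y z t : in4 s x y z t <-> in4 (f s) (f x) (f y) (f z) (f t).
Proof. unfold in4, is_opair, is_sing; transfer. Qed.
Hint Resolve in4_transfer : transfer.

Lemma F_computation_transfer s : F_computation s <-> F_computation (f s).
Proof. unfold F_computation; transfer. Qed.
Hint Resolve F_computation_transfer : transfer.

Lemma bigcup_F_eq_transfer m x : bigcup_F_eq m x <-> bigcup_F_eq (f m) (f x).
Proof. unfold bigcup_F_eq, is_F; transfer. Qed.
Hint Resolve bigcup_F_eq_transfer : transfer.

Lemma omega_step_transfer s m x y :
  omega_step s m x y <-> omega_step (f s) (f m) (f x) (f y).
Proof. unfold omega_step, first_omega_number; transfer. Qed.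
Hint Resolve omega_step_transfer : transfer.

Lemma omega_computation_transfer s : omega_computation s <-> omega_computation (f s).
Proof. unfold omega_computation, first_omega_number; transfer. Qed.
Hint Resolve omega_computation_transfer : transfer.

Lemma is_omega_mul_transfer m a n y :
  is_omega_mul m a n y <-> is_omega_mul (f m) (f a) (f n) (f y).
Proof. unfold is_omega_mul; transfer. Qed.
Hint Resolve is_omega_mul_transfer : transfer.

Lemma sat_transfer p : forall r : nat -> M, sat r p <-> sat (fun i => f (r i)) p.
Proof.
  induction p; intros r; simpl; transfer; rewrite IHp; apply sat_ext; now intros [|i].
Qed.

Lemma is_model_transfer : is_model M -> is_model N.
Proof.
  intros H.
  (* Separation is the one axiom with an environment of parameters in [N]; choice lifts it to [M]
     pointwise. *)
  assert (lift : forall r : nat -> N, exists s : nat -> M, r = fun i => f (s i)).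
  { intros r. exists (fun i => epsilon (inhabits (at_o M)) (fun x => f x = r i)).
    apply functional_extensionality; intros i; symmetry.
    apply (epsilon_spec (inhabits (at_o M)) (fun x => f x = r i)), f_surj. }
  constructor.
  - refine (proj1 (_ : _ <-> _) (ax_equality H)); transfer.
  - refine (proj1 (_ : _ <-> _) (ax_individuals H)); transfer.
  - refine (proj1 (_ : _ <-> _) (ax_pairs H)); transfer.
  - refine (proj1 (_ : _ <-> _) (ax_regularity H)); transfer.
  - refine (proj1 (_ : _ <-> _) (ax_union H)); transfer.
  - refine (proj1 (_ : _ <-> _) (ax_power H)); transfer.
  - intros Phi r0. destruct (lift r0) as [r ->].
    refine (proj1 (_ : _ <-> _) (@ax_separation _ H Phi r)); transfer;
      rewrite sat_transfer; apply sat_ext; now intros [|i].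
  - refine (proj1 (_ : _ <-> _) (ax_o H)); unfold individual; transfer.
  - refine (proj1 (_ : _ <-> _) (ax_e H)); unfold individual; transfer.
  - refine (proj1 (_ : _ <-> _) (ax_o_neq_e H)); transfer.
  - refine (proj1 (_ : _ <-> _) (ax_infinity H)); transfer.
Qed.

End Transfer.

(** * The quotient by coextensionality, by chosen representatives *)

Section Representatives.

Context (M : structure) (hM : is_model M).

Definition repr (x : M) : M := epsilon (inhabits (at_o M)) (eqs x).

Lemma repr_eqs x : eqs x (repr x).
Proof. apply (epsilon_spec (inhabits (at_o M)) (eqs x)); exists x; now intros u. Qed.

(** For coextensional sets the predicates [eqs x] and [eqs y] are equal, by functional and
    propositional extensionality, so the choice operator returns the same set for both. *)
Lemma repr_congr x y : eqs x y -> repr x = repr y.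
Proof.
  intros H; unfold repr; f_equal.
  apply functional_extensionality; intros z; apply propositional_extensionality.
  unfold eqs in *; split; intros K u; [now rewrite <- H|now rewrite H].
Qed.

Lemma repr_idem x : repr (repr x) = repr x.
Proof. symmetry; apply repr_congr, repr_eqs. Qed.

(** The fixed points of [repr] serve as the quotient; by proof irrelevance two of them are equal as
    soon as their underlying sets are. *)
Definition canonical : Type := {x : M | repr x = x}.

Definition canon (x : M) : canonical := exist _ (repr x) (repr_idem x).

Definition reprs : structure :=
  @Structure canonical (fun x y => proj1_sig x ∈ proj1_sig y)
    (canon (at_o M)) (canon (at_e M)).

Lemma canon_surj (y : reprs) : exists x, canon x = y.
Proof.
  destruct y as [x Hx]; exists x; unfold canon.
  apply subset_eq_compat, Hx.
Qed.

(** Replacing the right-hand set by its representative is the definition of [eqs]; replacing the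
    left-hand one is the axiom of equality. *)
Lemma canon_mem (x y : M) : x ∈ y <-> @mem reprs (canon x) (canon y).
Proof.
  simpl. rewrite <- (repr_eqs y (repr x)).
  apply (ax_equality hM), repr_eqs.
Qed.

Lemma reprs_ext (x y : reprs) : eqs x y -> x = y.
Proof.
  destruct (canon_surj x) as [a <-], (canon_surj y) as [b <-]; intros H.
  apply subset_eq_compat, repr_congr; intros u.
  rewrite (canon_mem u a), (canon_mem u b); apply H.
Qed.

End Representatives.

(** * Predicates definable with parameters *)

Fixpoint rename (f : nat -> nat) (p : formula) : formula :=
  match p with
  | FMem i j => FMem (f i) (f j)
  | FNot p1 => FNot (rename f p1)
  | FAnd p1 p2 => FAnd (rename f p1) (rename f p2)
  | FOr p1 p2 => FOr (rename f p1) (rename f p2)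
  | FImp p1 p2 => FImp (rename f p1) (rename f p2)
  | FAll p1 => FAll (rename (scons 0 (fun i => S (f i))) p1)
  | FEx p1 => FEx (rename (scons 0 (fun i => S (f i))) p1)
  end.

Lemma sat_rename (M : structure) p : forall (r : nat -> M) f,
  sat r (rename f p) <-> sat (fun i => r (f i)) p.
Proof.
  induction p; intros r f; simpl.
  - tauto.
  - apply not_iff_compat, IHp.
  - apply and_congr; auto.
  - apply or_congr; auto.
  - apply imp_congr; auto.
  - assert (H : forall a, sat (scons a r) (rename (scons 0 (fun i => S (f i))) p)
      <-> sat (scons a (fun i => r (f i))) p)
      by (intros a; rewrite IHp; apply sat_ext; now intros [|i]).
    split; intros K a; apply H, K.
  - assert (H : forall a, sat (scons a r) (rename (scons 0 (fun i => S (f i))) p)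
      <-> sat (scons a (fun i => r (f i))) p)
      by (intros a; rewrite IHp; apply sat_ext; now intros [|i]).
    split; intros [a K]; exists a; apply H, K.
Qed.

Section Definability.

Context {M : structure}.

(* The first n variables come from r, the others are parameters. *)
Definition mix (n : nat) (r p : nat -> M) (i : nat) : M :=
  if i <? n then r i else p (i - n).

(** The parameters are quantified existentially along with the formula, so sets of the model
    occurring in a predicate need no bookkeeping. *)
Definition definable (n : nat) (P : (nat -> M) -> Prop) : Prop :=
  exists Phi p, forall r, P r <-> sat (mix n r p) Phi.

(** The language has no function symbols: an argument of a definable relation is a variable or a
    parameter. *)
Definition simple_term (n : nat) (t : (nat -> M) -> M) : Prop :=
  (exists i, i < n /\ forall r, t r = r i) \/ (exists c, forall r, t r = c).

Lemma simple_var n i : i < n -> simple_term n (fun r => r i).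
Proof. left; exists i; auto. Qed.

Lemma simple_const n c : simple_term n (fun _ => c).
Proof. right; exists c; auto. Qed.

(** A connective needs one parameter sequence for both formulas. The two sequences are interleaved,
    one at the even and one at the odd positions, and the formulas are renumbered accordingly beyond
    the first [n] variables. *)
Lemma definable_pair n P Q : definable n P -> definable n Q ->
  exists Phi Psi p, (forall r, P r <-> sat (mix n r p) Phi) /\
                    (forall r, Q r <-> sat (mix n r p) Psi).
Proof.
  intros [Phi [p HP]] [Psi [q HQ]].
  exists (rename (fun i => if i <? n then i else n + 2 * (i - n)) Phi).
  exists (rename (fun i => if i <? n then i else n + (1 + 2 * (i - n))) Psi).
  exists (fun i => if Nat.even i then p (Nat.div2 i) else q (Nat.div2 i)).
  split; intros r; [rewrite HP|rewrite HQ]; rewrite sat_rename;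
    apply sat_ext; intros i; unfold mix; destruct (Nat.ltb_spec i n) as [H|H].
  - now destruct (Nat.ltb_spec i n); [|lia].
  - destruct (Nat.ltb_spec (n + 2 * (i - n)) n); [lia|].
    replace (n + 2 * (i - n) - n) with (2 * (i - n)) by lia.
    now rewrite Nat.even_mul, Nat.div2_double.
  - now destruct (Nat.ltb_spec i n); [|lia].
  - destruct (Nat.ltb_spec (n + (1 + 2 * (i - n))) n); [lia|].
    replace (n + (1 + 2 * (i - n)) - n) with (S (2 * (i - n))) by lia.
    now rewrite Nat.even_succ, Nat.odd_mul, Nat.div2_succ_double.
Qed.

Lemma definable_not n P : definable n P -> definable n (fun r => ~ P r).
Proof.
  intros [Phi [p H]]; exists (FNot Phi), p; intros r; simpl; now rewrite H.
Qed.

Lemma definable_and n P Q : definable n P -> definable n Q -> definable n (fun r => P r /\ Q r).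
Proof.
  intros HP HQ; destruct (definable_pair HP HQ) as [Phi [Psi [p [H K]]]].
  exists (FAnd Phi Psi), p; intros r; simpl; now rewrite H, K.
Qed.

Lemma definable_or n P Q : definable n P -> definable n Q -> definable n (fun r => P r \/ Q r).
Proof.
  intros HP HQ; destruct (definable_pair HP HQ) as [Phi [Psi [p [H K]]]].
  exists (FOr Phi Psi), p; intros r; simpl; now rewrite H, K.
Qed.

Lemma definable_imp n (P Q : (nat -> M) -> Prop) :
  definable n P -> definable n Q -> definable n (fun r => P r -> Q r).
Proof.
  intros HP HQ; destruct (definable_pair HP HQ) as [Phi [Psi [p [H K]]]].
  exists (FImp Phi Psi), p; intros r; simpl; now rewrite H, K.
Qed.

Lemma definable_iff n P Q : definable n P -> definable n Q -> definable n (fun r => P r <-> Q r).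
Proof.
  intros HP HQ; apply definable_and; apply definable_imp; assumption.
Qed.

Lemma scons_mix n a r p i : scons a (mix n r p) i = mix (S n) (scons a r) p i.
Proof. now destruct i. Qed.

Lemma definable_all n (P : M -> (nat -> M) -> Prop) :
  definable (S n) (fun r => P (r 0) (fun i => r (S i))) ->
  definable n (fun r => forall x, P x r).
Proof.
  intros [Phi [p H]]; exists (FAll Phi), p; intros r; simpl.
  split; intros K a; specialize (K a).
  - apply (H (scons a r)) in K.
    now rewrite (sat_ext Phi (scons_mix n a r p)).
  - rewrite (sat_ext Phi (scons_mix n a r p)) in K. now apply H in K.
Qed.

Lemma definable_ex n (P : M -> (nat -> M) -> Prop) :
  definable (S n) (fun r => P (r 0) (fun i => r (S i))) ->
  definable n (fun r => exists x, P x r).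
Proof.
  intros [Phi [p H]]; exists (FEx Phi), p; intros r; simpl.
  split; intros [a K]; exists a.
  - apply (H (scons a r)) in K.
    now rewrite (sat_ext Phi (scons_mix n a r p)).
  - rewrite (sat_ext Phi (scons_mix n a r p)) in K. now apply H in K.
Qed.

(** The first [k] entries of the new parameter sequence hold the constants among the substituted
    terms, with a filler where the term is a variable; the old parameters follow. Hence index i >= k
    becomes n + i, whose parameter is the old one at i - k. *)
Lemma definable_subst k n P (t : nat -> (nat -> M) -> M) :
  definable k P -> (forall i, i < k -> simple_term n (t i)) ->
  definable n (fun r => P (fun i => t i r)).
Proof.
  intros [Phi [p H]] T.
  assert (E : forall i, exists jc : nat * M, i < k ->
    forall r q, q i = snd jc -> t i r = mix n r q (fst jc) /\
                (fst jc < n \/ fst jc = n + i)).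
  { intros i. destruct (classic (i < k)) as [L|L].
    - destruct (T i L) as [[j [Hj Ej]]|[c Ec]].
      + exists (j, at_o M); intros _ r q _; unfold mix; simpl.
        destruct (Nat.ltb_spec j n); [auto|lia].
      + exists (n + i, c); intros _ r q Hq; unfold mix; simpl in *.
        destruct (Nat.ltb_spec (n + i) n); [lia|].
        replace (n + i - n) with i by lia. now rewrite Hq, Ec; auto.
    - now exists (0, at_o M). }
  destruct (choice _ E) as [g Hg].
  exists (rename (fun i => if i <? k then fst (g i) else n + i) Phi).
  exists (fun i => if i <? k then snd (g i) else p (i - k)).
  intros r; rewrite H, sat_rename; apply sat_ext; intros i.
  unfold mix at 1; destruct (Nat.ltb_spec i k) as [L|L].
  - apply (Hg i L). now destruct (Nat.ltb_spec i k); [|lia].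
  - unfold mix. destruct (Nat.ltb_spec (n + i) n); [lia|].
    replace (n + i - n) with i by lia.
    now destruct (Nat.ltb_spec i k); [lia|].
Qed.

(** This and its analogues of higher arity reduce definability at arbitrary simple arguments to
    definability at the variables themselves, so each notion has to be unfolded only once. *)
Lemma definable_subst1 n (R : M -> Prop) a :
  definable 1 (fun r => R (r 0)) -> simple_term n a -> definable n (fun r => R (a r)).
Proof.
  intros H Ha.
  refine (definable_subst (t := scons a (fun _ => a)) H _).
  intros [|i] L; simpl; auto; lia.
Qed.

Lemma definable_subst2 n (R : M -> M -> Prop) a b :
  definable 2 (fun r => R (r 0) (r 1)) ->
  simple_term n a -> simple_term n b -> definable n (fun r => R (a r) (b r)).
Proof.
  intros H Ha Hb.
  refine (definable_subst (t := scons a (fun _ => b)) H _).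
  intros [|i] L; simpl; auto.
Qed.

Lemma definable_subst3 n (R : M -> M -> M -> Prop) a b c :
  definable 3 (fun r => R (r 0) (r 1) (r 2)) ->
  simple_term n a -> simple_term n b -> simple_term n c ->
  definable n (fun r => R (a r) (b r) (c r)).
Proof.
  intros H Ha Hb Hc.
  refine (definable_subst (t := scons a (scons b (fun _ => c))) H _).
  intros [|[|i]] L; simpl; auto.
Qed.

Lemma definable_subst4 n (R : M -> M -> M -> M -> Prop) a b c d :
  definable 4 (fun r => R (r 0) (r 1) (r 2) (r 3)) ->
  simple_term n a -> simple_term n b -> simple_term n c -> simple_term n d ->
  definable n (fun r => R (a r) (b r) (c r) (d r)).
Proof.
  intros H Ha Hb Hc Hd.
  refine (definable_subst (t := scons a (scons b (scons c (fun _ => d)))) H _).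
  intros [|[|[|i]]] L; simpl; auto.
Qed.

Lemma definable_subst5 n (R : M -> M -> M -> M -> M -> Prop) a b c d e :
  definable 5 (fun r => R (r 0) (r 1) (r 2) (r 3) (r 4)) ->
  simple_term n a -> simple_term n b -> simple_term n c -> simple_term n d ->
  simple_term n e -> definable n (fun r => R (a r) (b r) (c r) (d r) (e r)).
Proof.
  intros H Ha Hb Hc Hd He.
  refine (definable_subst (t := scons a (scons b (scons c (scons d (fun _ => e))))) H _).
  intros [|[|[|[|i]]]] L; simpl; auto.
Qed.

Lemma definable_mem n a b :
  simple_term n a -> simple_term n b -> definable n (fun r => a r ∈ b r).
Proof.
  apply definable_subst2. now exists (FMem 0 1), (fun _ => at_o M).
Qed.

End Definability.

(* Definability of the notions of the theory *)
Create HintDb definable.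

Ltac simple_term_tac :=
  first [ apply simple_const | apply simple_var; lia ].

#[export] Hint Extern 1 (simple_term _ _) => simple_term_tac : definable.

Ltac definable_tac :=
  repeat (cbv beta; match goal with
  | |- simple_term _ _ => simple_term_tac
  | |- definable _ (fun r => _ /\ _) => apply definable_and
  | |- definable _ (fun r => _ \/ _) => apply definable_or
  | |- definable _ (fun r => ~ _) => apply definable_not
  | |- definable _ (fun r => _ <-> _) => apply definable_iff
  | |- definable _ (fun r => mem _ _) => apply definable_mem
  | |- definable _ (fun r => forall x : carrier _, _) => apply definable_all
  | |- definable _ (fun r => exists x : carrier _, _) => apply definable_ex
  | |- definable _ (fun r => _ -> _) => apply definable_imp
  | |- definable _ _ => progress auto with definable nocore
  end).

Lemma definable_eqs (M : structure) n (a b : (nat -> M) -> M) :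
  simple_term n a -> simple_term n b ->
  definable n (fun r => eqs (a r) (b r)).
Proof. apply definable_subst2; unfold eqs; definable_tac. Qed.
#[export] Hint Resolve definable_eqs : definable.

Lemma definable_subs (M : structure) n (a b : (nat -> M) -> M) :
  simple_term n a -> simple_term n b ->
  definable n (fun r => subs (a r) (b r)).
Proof. apply definable_subst2; unfold subs; definable_tac. Qed.
#[export] Hint Resolve definable_subs : definable.

Lemma definable_is_pair (M : structure) n (a b c : (nat -> M) -> M) :
  simple_term n a -> simple_term n b -> simple_term n c ->
  definable n (fun r => is_pair (a r) (b r) (c r)).
Proof. apply definable_subst3; unfold is_pair; definable_tac. Qed.
#[export] Hint Resolve definable_is_pair : definable.

Lemma definable_is_sing (M : structure) n (a b : (nat -> M) -> M) :
  simple_term n a -> simple_term n b ->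
  definable n (fun r => is_sing (a r) (b r)).
Proof. apply definable_subst2; unfold is_sing; definable_tac. Qed.
#[export] Hint Resolve definable_is_sing : definable.

Lemma definable_is_bigcup (M : structure) n (a b : (nat -> M) -> M) :
  simple_term n a -> simple_term n b ->
  definable n (fun r => is_bigcup (a r) (b r)).
Proof. apply definable_subst2; unfold is_bigcup; definable_tac. Qed.
#[export] Hint Resolve definable_is_bigcup : definable.

Lemma definable_is_succ (M : structure) n (a b : (nat -> M) -> M) :
  simple_term n a -> simple_term n b ->
  definable n (fun r => is_succ (a r) (b r)).
Proof. apply definable_subst2; unfold is_succ, is_cup; definable_tac. Qed.
#[export] Hint Resolve definable_is_succ : definable.

Lemma definable_is_zero (M : structure) n (a : (nat -> M) -> M) :
  simple_term n a ->
  definable n (fun r => is_zero (a r)).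
Proof. apply definable_subst1; unfold is_zero; definable_tac. Qed.
#[export] Hint Resolve definable_is_zero : definable.

Lemma definable_in_zero (M : structure) n (a : (nat -> M) -> M) :
  simple_term n a ->
  definable n (fun r => in_zero (a r)).
Proof. apply definable_subst1; unfold in_zero; definable_tac. Qed.
#[export] Hint Resolve definable_in_zero : definable.

Lemma definable_in_succ_zero (M : structure) n (a : (nat -> M) -> M) :
  simple_term n a ->
  definable n (fun r => in_succ_zero (a r)).
Proof. apply definable_subst1; unfold in_succ_zero; definable_tac. Qed.
#[export] Hint Resolve definable_in_succ_zero : definable.

Lemma definable_individual (M : structure) n (a : (nat -> M) -> M) :
  simple_term n a ->
  definable n (fun r => individual (a r)).
Proof. apply definable_subst1; unfold individual; definable_tac. Qed.
#[export] Hint Resolve definable_individual : definable.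

Lemma definable_transitive (M : structure) n (a : (nat -> M) -> M) :
  simple_term n a ->
  definable n (fun r => transitive (a r)).
Proof. apply definable_subst1; unfold transitive; definable_tac. Qed.
#[export] Hint Resolve definable_transitive : definable.

Lemma definable_natural (M : structure) n (a : (nat -> M) -> M) :
  simple_term n a ->
  definable n (fun r => natural (a r)).
Proof. apply definable_subst1; unfold natural, transitive_set_with_transitive_members; definable_tac. Qed.
#[export] Hint Resolve definable_natural : definable.

Lemma definable_ordinal (M : structure) n (a : (nat -> M) -> M) :
  simple_term n a ->
  definable n (fun r => ordinal (a r)).
Proof. apply definable_subst1; unfold ordinal, transitive_set_with_transitive_members; definable_tac. Qed.
#[export] Hint Resolve definable_ordinal : definable.

Lemma definable_is_opair (M : structure) n (a b c : (nat -> M) -> M) :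
  simple_term n a -> simple_term n b -> simple_term n c ->
  definable n (fun r => is_opair (a r) (b r) (c r)).
Proof. apply definable_subst3; unfold is_opair; definable_tac. Qed.
#[export] Hint Resolve definable_is_opair : definable.

Lemma definable_in3 (M : structure) n (a b c d : (nat -> M) -> M) :
  simple_term n a -> simple_term n b -> simple_term n c -> simple_term n d ->
  definable n (fun r => in3 (a r) (b r) (c r) (d r)).
Proof. apply definable_subst4; unfold in3; definable_tac. Qed.
#[export] Hint Resolve definable_in3 : definable.

Lemma definable_in4 (M : structure) n (a b c d e : (nat -> M) -> M) :
  simple_term n a -> simple_term n b -> simple_term n c -> simple_term n d -> simple_term n e ->
  definable n (fun r => in4 (a r) (b r) (c r) (d r) (e r)).
Proof. apply definable_subst5; unfold in4; definable_tac. Qed.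
#[export] Hint Resolve definable_in4 : definable.

Lemma definable_F_computation (M : structure) n (a : (nat -> M) -> M) :
  simple_term n a ->
  definable n (fun r => F_computation (a r)).
Proof. apply definable_subst1; unfold F_computation; definable_tac. Qed.
#[export] Hint Resolve definable_F_computation : definable.

Lemma definable_is_F (M : structure) n (a b c : (nat -> M) -> M) :
  simple_term n a -> simple_term n b -> simple_term n c ->
  definable n (fun r => is_F (a r) (b r) (c r)).
Proof. apply definable_subst3; unfold is_F; definable_tac. Qed.
#[export] Hint Resolve definable_is_F : definable.

Lemma definable_bigcup_F_eq (M : structure) n (a b : (nat -> M) -> M) :
  simple_term n a -> simple_term n b ->
  definable n (fun r => bigcup_F_eq (a r) (b r)).
Proof. apply definable_subst2; unfold bigcup_F_eq; definable_tac. Qed.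
#[export] Hint Resolve definable_bigcup_F_eq : definable.

Lemma definable_first_omega_number (M : structure) n (a b : (nat -> M) -> M) :
  simple_term n a -> simple_term n b ->
  definable n (fun r => first_omega_number (a r) (b r)).
Proof. apply definable_subst2; unfold first_omega_number; definable_tac. Qed.
#[export] Hint Resolve definable_first_omega_number : definable.

Lemma definable_omega_step (M : structure) n (a b c d : (nat -> M) -> M) :
  simple_term n a -> simple_term n b -> simple_term n c -> simple_term n d ->
  definable n (fun r => omega_step (a r) (b r) (c r) (d r)).
Proof. apply definable_subst4; unfold omega_step; definable_tac. Qed.
#[export] Hint Resolve definable_omega_step : definable.

Lemma definable_omega_computation (M : structure) n (a : (nat -> M) -> M) :
  simple_term n a ->
  definable n (fun r => omega_computation (a r)).
Proof. apply definable_subst1; unfold omega_computation; definable_tac. Qed.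
#[export] Hint Resolve definable_omega_computation : definable.

Lemma definable_is_omega_mul (M : structure) n (a b c d : (nat -> M) -> M) :
  simple_term n a -> simple_term n b -> simple_term n c -> simple_term n d ->
  definable n (fun r => is_omega_mul (a r) (b r) (c r) (d r)).
Proof. apply definable_subst4; unfold is_omega_mul; definable_tac. Qed.
#[export] Hint Resolve definable_is_omega_mul : definable.

(** * Set operations in an extensional model *)

Section Extensional.

Context {M : structure} (hM : is_model M) (ext : forall s t : M, eqs s t -> s = t).

Notation o := (at_o M).
Notation e := (at_e M).

Lemma eqs_eq (s t : M) : eqs s t <-> s = t.
Proof using ext. split; [apply ext|intros ->; now intros u]. Qed.

(** Leibniz equality is outside the language, but in an extensional model it coincides with
    [eqs]. *)
Lemma definable_eq n (a b : (nat -> M) -> M) : simple_term n a -> simple_term n b ->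
  definable n (fun r => a r = b r).
Proof using ext.
  apply definable_subst2.
  destruct (definable_eqs (n := 2) (a := fun r => r 0) (b := fun r : nat -> M => r 1))
    as [Phi [p H]]; [simple_term_tac..|].
  exists Phi, p; intros r; now rewrite <- eqs_eq.
Qed.
Hint Resolve definable_eq : definable.

Lemma separation (P : M -> Prop) s : definable 1 (fun r => P (r 0)) ->
  (exists u, u ∈ s /\ P u) -> exists v, forall u, u ∈ v <-> u ∈ s /\ P u.
Proof using hM.
  intros [Phi [p H]] [u [Hu Pu]].
  assert (K : forall u, P u <-> sat (scons u p) Phi).
  { intros w. rewrite (H (scons w p)). apply sat_ext.
    intros [|i]; unfold mix; simpl; auto. now rewrite Nat.sub_0_r. }
  destruct (@ax_separation _ hM Phi p s) as [v Hv].
  - exists u; split; [auto|now apply K].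
  - exists v; intros w. now rewrite K.
Qed.

Definition the (P : M -> Prop) : M := epsilon (inhabits o) P.

Lemma the_spec (P : M -> Prop) : (exists x, P x) -> P (the P).
Proof using. apply epsilon_spec. Qed.

Definition pr (s t : M) : M := the (is_pair s t).

Lemma is_pair_pr s t : is_pair s t (pr s t).
Proof using hM. apply (@the_spec (is_pair s t)), (ax_pairs hM). Qed.

Lemma in_pr s t u : u ∈ pr s t <-> u = s \/ u = t.
Proof using hM ext. now rewrite (is_pair_pr s t u), !eqs_eq. Qed.

Lemma is_pairE s t v : is_pair s t v <-> v = pr s t.
Proof using hM ext.
  split; [|intros ->; apply is_pair_pr].
  intros H; apply ext; intros u. now rewrite (H u), (is_pair_pr s t u).
Qed.

Definition bigcup (s : M) : M := the (is_bigcup s).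

Lemma in_bigcup s u : u ∈ bigcup s <-> exists w, w ∈ s /\ u ∈ w.
Proof using hM. revert u; apply (@the_spec (is_bigcup s)), (ax_union hM). Qed.

Lemma is_bigcupE s v : is_bigcup s v <-> v = bigcup s.
Proof using hM ext.
  split; [|intros ->; intro; apply in_bigcup].
  intros H; apply ext; intros u. now rewrite (H u), in_bigcup.
Qed.

Definition cup (s t : M) : M := bigcup (pr s t).

Lemma in_cup s t u : u ∈ cup s t <-> u ∈ s \/ u ∈ t.
Proof using hM ext.
  unfold cup; rewrite in_bigcup; split.
  - intros [w [Hw Hu]]; apply in_pr in Hw as [->| ->]; auto.
  - intros [H|H]; [exists s|exists t]; rewrite in_pr; auto.
Qed.

Lemma is_cupE s t v : is_cup s t v <-> v = cup s t.
Proof using hM ext.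
  unfold is_cup, cup; split.
  - intros [p [Hp Hv]]; apply is_pairE in Hp as ->; now apply is_bigcupE.
  - intros ->; exists (pr s t); now rewrite is_pairE, is_bigcupE.
Qed.

Definition succ (s : M) : M := cup s (pr s s).

Lemma in_succ s u : u ∈ succ s <-> u ∈ s \/ u = s.
Proof using hM ext. unfold succ; rewrite in_cup, in_pr; tauto. Qed.

Lemma is_succE s v : is_succ s v <-> v = succ s.
Proof using hM ext.
  unfold is_succ, is_sing, succ; split.
  - intros [q [Hq Hv]]; apply is_pairE in Hq as ->; now apply is_cupE.
  - intros ->; exists (pr s s); now rewrite is_pairE, is_cupE.
Qed.

Definition zero : M := pr o e.

Lemma in_zeroset u : u ∈ zero <-> u = o \/ u = e.
Proof using hM ext. apply in_pr. Qed.

Lemma is_zeroE v : is_zero v <-> v = zero.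
Proof using hM ext. apply is_pairE. Qed.

Lemma in_zeroE u : in_zero u <-> u ∈ zero.
Proof using hM ext.
  unfold in_zero; split.
  - intros [z [Hz Hu]]; now apply is_zeroE in Hz as ->.
  - intros H; exists zero; now rewrite is_zeroE.
Qed.

Lemma in_succ_zeroE u : in_succ_zero u <-> u ∈ zero \/ u = zero.
Proof using hM ext.
  unfold in_succ_zero; split.
  - intros [z [z1 [Hz [Hs Hu]]]]; apply is_zeroE in Hz as ->; apply is_succE in Hs as ->.
    now apply in_succ.
  - intros H; exists zero, (succ zero); now rewrite is_zeroE, is_succE, in_succ.
Qed.

(** * Ordered pairs and tuples *)

Definition opair (a b : M) : M := pr (pr a a) (pr a b).

Lemma is_opairE a b p : is_opair a b p <-> p = opair a b.
Proof using hM ext.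
  unfold is_opair, is_sing; split.
  - intros [q [r [Hq [Hr Hp]]]].
    apply is_pairE in Hq as ->; apply is_pairE in Hr as ->; now apply is_pairE.
  - intros ->; exists (pr a a), (pr a b); now rewrite !is_pairE.
Qed.

Lemma pr_inj a b c d : pr a b = pr c d -> (a = c /\ b = d) \/ (a = d /\ b = c).
Proof using hM ext.
  intros H.
  assert (K : forall u, (u = a \/ u = b) <-> (u = c \/ u = d))
    by (intros u; now rewrite <- !in_pr, H).
  destruct (proj1 (K a) (or_introl eq_refl)) as [<-|<-].
  - destruct (proj1 (K b) (or_intror eq_refl)) as [-> |<-]; auto.
    destruct (proj2 (K d) (or_intror eq_refl)); auto.
  - destruct (proj1 (K b) (or_intror eq_refl)) as [<-| ->]; auto.
    destruct (proj2 (K c) (or_introl eq_refl)); auto.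
Qed.

Lemma opair_inj a b c d : opair a b = opair c d -> a = c /\ b = d.
Proof using hM ext.
  unfold opair; intros H.
  assert (a = c).
  { apply pr_inj in H as [[H _]|[_ H]]; apply pr_inj in H; intuition congruence. }
  subst c; split; auto.
  apply pr_inj in H as [[_ H]|[H K]].
  - apply pr_inj in H; intuition congruence.
  - apply pr_inj in H; apply pr_inj in K; intuition congruence.
Qed.

Definition tuple3 (a b c : M) : M := opair (opair a b) c.
Definition tuple4 (a b c d : M) : M := opair (tuple3 a b c) d.

Lemma tuple3_inj a b c a' b' c' :
  tuple3 a b c = tuple3 a' b' c' -> a = a' /\ b = b' /\ c = c'.
Proof using hM ext.
  intros H; apply opair_inj in H as [H ->]; apply opair_inj in H; tauto.
Qed.

Lemma tuple4_inj a b c d a' b' c' d' :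
  tuple4 a b c d = tuple4 a' b' c' d' -> a = a' /\ b = b' /\ c = c' /\ d = d'.
Proof using hM ext.
  intros H; apply opair_inj in H as [H ->]; apply tuple3_inj in H; tauto.
Qed.

Lemma in3E S a b c : in3 S a b c <-> tuple3 a b c ∈ S.
Proof using hM ext.
  unfold in3, tuple3; split.
  - intros [p [q [Hp [Hq H]]]]; apply is_opairE in Hp as ->; now apply is_opairE in Hq as ->.
  - intros H; exists (opair a b), (tuple3 a b c); now rewrite !is_opairE.
Qed.

Lemma in4E S a b c d : in4 S a b c d <-> tuple4 a b c d ∈ S.
Proof using hM ext.
  unfold in4, tuple4, tuple3; split.
  - intros [p [q [r [Hp [Hq [Hr H]]]]]]; apply is_opairE in Hp as ->.
    apply is_opairE in Hq as ->; now apply is_opairE in Hr as ->.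
  - intros H; exists (opair a b), (tuple3 a b c), (tuple4 a b c d).
    unfold tuple4, tuple3; now rewrite !is_opairE.
Qed.

Lemma power_exists (s : M) : exists v, forall u, u ∈ v <-> subs u s.
Proof using hM. apply (ax_power hM). Qed.

(** An upper bound is enough, since separation cuts it down later: Kuratowski pairs lie in the
    double power set of the union. *)
Lemma product_exists A B : exists C, forall a b, a ∈ A -> b ∈ B -> opair a b ∈ C.
Proof using hM ext.
  destruct (power_exists (cup A B)) as [P HP], (power_exists P) as [C HC].
  exists C; intros a b Ha Hb; apply HC; intros u Hu; apply HP; intros w Hw.
  apply in_cup; apply in_pr in Hu as [->| ->]; apply in_pr in Hw as [->| ->]; auto.
Qed.

(** * Individuals and regularity *)

Lemma nonempty s : exists u : M, u ∈ s.
Proof using hM. destruct (ax_regularity hM s) as [v [[H _]|[H _]]]; eauto. Qed.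

Lemma in_individual (a u : M) : a ∈ a -> u ∈ a <-> u = a.
Proof using hM ext.
  intros H; split; [intros K; apply ext, (ax_individuals hM H K)|now intros ->].
Qed.

Lemma o_individual : o ∈ o.
Proof using hM. apply (ax_o hM). Qed.

Lemma e_individual : e ∈ e.
Proof using hM. apply (ax_e hM). Qed.

Lemma zero_individual a : a ∈ zero -> a ∈ a.
Proof using hM ext.
  rewrite in_zeroset; intros [->| ->]; [apply o_individual|apply e_individual].
Qed.

Lemma zero_not_individual : zero ∉ zero.
Proof using hM ext.
  intros H.
  assert (K : forall u, u ∈ zero -> u = zero) by (intros u; now apply in_individual).
  apply (ax_o_neq_e hM), eqs_eq.
  rewrite (K o), (K e); auto; apply in_zeroset; auto.
Qed.

(** Regularity is applied to the set of those members of [s] that satisfy [P] and are not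
    individuals; this restriction rules out its first alternative. *)
Lemma minimal (P : M -> Prop) s : definable 1 (fun r => P (r 0)) ->
  (exists u, u ∈ s /\ u ∉ u /\ P u) ->
  exists v, v ∈ s /\ v ∉ v /\ P v /\ (forall u, u ∈ v -> u ∈ s -> u ∉ u -> ~ P u).
Proof using hM.
  intros D [u [Hu [Nu Pu]]].
  destruct (@separation (fun u => u ∉ u /\ P u) s) as [t Ht].
  - definable_tac.
  - exists u; auto.
  - destruct (ax_regularity hM t) as [v [[H [K L]]|[H [K L]]]].
    + apply Ht in H; tauto.
    + apply Ht in H as [H1 [H2 H3]]; exists v; repeat split; auto.
      intros w Hw Hs Nw Pw; apply (L w); [auto|]. apply Ht; auto.
Qed.

(** Transitive sets with transitive members are more general than ordinals; this generality is what
    later shows that natural numbers are ordinals. *)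
Lemma trans_ind (P : M -> Prop) : definable 1 (fun r => P (r 0)) ->
  (forall s, s ∉ s -> transitive s -> (forall u, u ∈ s -> transitive u) ->
    (forall u, u ∈ s -> u ∉ u -> P u) -> P s) ->
  forall s, s ∉ s -> transitive s -> (forall u, u ∈ s -> transitive u) -> P s.
Proof using hM.
  intros D H s Ns Ts Tm. apply H; auto; intros u Hu Nu. apply NNPP; intros NP.
  destruct (@minimal (fun u => ~ P u) s) as [v [Hv [Nv [Pv Lv]]]];
    [definable_tac|eauto|].
  apply Pv, H; auto.
  - intros w Hw; apply Tm. now apply (Ts v).
  - intros w Hw Nw; apply NNPP; intros NPw. apply (Lv w); auto. now apply (Ts v).
Qed.

(** * Ordinals and natural numbers *)

Lemma individual_transitive (a : M) : a ∈ a -> transitive a.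
Proof using hM ext.
  intros H u Hu w Hw. apply in_individual in Hu as ->; auto.
Qed.

Lemma ordinalE (b : M) : ordinal b <->
  b ∉ b /\ transitive b /\ (forall u, u ∈ b -> transitive u) /\
  (forall u, u ∈ b -> u ∈ u -> u ∈ zero).
Proof using hM ext.
  unfold ordinal, transitive_set_with_transitive_members, individual; split.
  - intros [[H1 [H2 H3]] [_ H4]]; repeat split; auto.
    intros u Hu Iu; apply in_zeroE; auto.
  - intros [H1 [H2 [H3 H4]]]; repeat split; auto.
    + rewrite in_zeroE; intros H; apply H1; now apply zero_individual.
    + intros u [Hu Iu]; apply in_zeroE; auto.
Qed.

Lemma ordinal_irrefl (b : M) : ordinal b -> b ∉ b.
Proof using hM ext. rewrite ordinalE; tauto. Qed.

Lemma ordinal_trans (b u w : M) : ordinal b -> u ∈ b -> w ∈ u -> w ∈ b.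
Proof using hM ext. rewrite ordinalE; intros [_ [H _]] Hu Hw; now apply (H u). Qed.

Lemma ordinal_mem (b u : M) : ordinal b -> u ∈ b -> u ∉ u -> ordinal u.
Proof using hM ext.
  rewrite !ordinalE; intros [H1 [H2 [H3 H4]]] Hu Nu; repeat split; auto.
  - intros w Hw; apply H3; now apply (H2 u).
  - intros w Hw; apply H4; now apply (H2 u).
Qed.

Lemma ordinal_mem_cases (b u : M) : ordinal b -> u ∈ b -> u ∈ zero \/ ordinal u.
Proof using hM ext.
  intros Hb Hu; destruct (classic (u ∈ u)) as [I|N].
  - left; apply ordinalE in Hb; now apply Hb.
  - right; now apply (ordinal_mem Hb).
Qed.

Lemma ordinal_zero : ordinal zero.
Proof using hM ext.
  rewrite ordinalE; repeat split.
  - apply zero_not_individual.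
  - intros u Hu w Hw; pose proof (zero_individual Hu) as I.
    now apply (in_individual w I) in Hw as ->.
  - intros u Hu; apply individual_transitive, zero_individual, Hu.
  - auto.
Qed.

Lemma ordinal_ind (P : M -> Prop) : definable 1 (fun r => P (r 0)) ->
  (forall b, ordinal b -> (forall u, u ∈ b -> ordinal u -> P u) -> P b) ->
  forall b, ordinal b -> P b.
Proof using hM ext.
  intros D H b Hb. revert Hb.
  assert (K : b ∉ b /\ transitive b /\ (forall u, u ∈ b -> transitive u) -> ordinal b -> P b).
  { intros [H1 [H2 H3]]. revert b H1 H2 H3.
    apply (@trans_ind (fun b => ordinal b -> P b)); [definable_tac|].
    - intros s Ns _ _ IH Os. apply H; auto.
      intros u Hu Ou; apply IH; auto. now apply ordinal_irrefl. }
  intros Hb; apply K; auto. apply ordinalE in Hb; tauto.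
Qed.

Ltac ordinal_induction :=
  match goal with |- forall b, ordinal b -> @?P b =>
    apply (@ordinal_ind P); [definable_tac|]; cbv beta end.

Lemma ordinal_least (P : M -> Prop) b : definable 1 (fun r => P (r 0)) ->
  ordinal b -> P b ->
  exists c, ordinal c /\ (c = b \/ c ∈ b) /\ P c /\ (forall u, u ∈ c -> ordinal u -> ~ P u).
Proof using hM ext.
  intros D Hb Pb.
  destruct (classic (exists u, u ∈ b /\ u ∉ u /\ P u)) as [E|E].
  - destruct (minimal D E) as [v [Hv [Nv [Pv Lv]]]].
    exists v; split; [now apply (ordinal_mem Hb)|split; [auto|split; [auto|]]].
    intros u Hu Ou; apply Lv; eauto using ordinal_trans, ordinal_irrefl.
  - exists b; split; [auto|split; [auto|split; [auto|]]]. intros u Hu Ou Pu; apply E; exists u.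
    eauto using ordinal_irrefl.
Qed.

(** If [b] has an ordinal member, induction applies to it. Otherwise the members of [b] are among o
    and e; if only one of them belonged to [b], then [b] would have the same members as that
    individual and be equal to it, which an ordinal cannot be. *)
Lemma zero_least (b : M) : ordinal b -> b = zero \/ zero ∈ b.
Proof using hM ext.
  revert b; ordinal_induction; intros b Hb IH.
  destruct (classic (exists u, u ∈ b /\ ordinal u)) as [[u [Hu Ou]]|E].
  - right. destruct (IH u Hu Ou) as [->|H]; eauto using ordinal_trans.
  - left. assert (K : forall u, u ∈ b -> u ∈ zero).
    { intros u Hu; destruct (ordinal_mem_cases Hb Hu); auto. exfalso; eauto. }
    assert (F : forall a c, a ∈ zero -> c ∈ zero -> a ∈ b -> c ∉ b -> False).
    { intros a c Ha Hc Hab Hcb.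
      apply (ordinal_irrefl Hb). replace b with a; [now apply zero_individual|].
      apply ext; intros u; rewrite (in_individual _ (zero_individual Ha)).
      split; [intros ->; exact Hab|]. intros Hu.
      pose proof (K u Hu) as Hu0. apply in_zeroset in Hu0, Ha, Hc.
      destruct Hu0, Ha, Hc; subst; tauto. }
    apply ext; intros u; split; auto; intros Hu.
    destruct (nonempty b) as [a Ha]. apply NNPP; eauto.
Qed.

Lemma zero_subset (b a : M) : ordinal b -> a ∈ zero -> a ∈ b.
Proof using hM ext.
  intros Hb Ha; destruct (zero_least Hb) as [->|H]; eauto using ordinal_trans.
Qed.

(** Double induction: if [a] and [b] are incomparable, the induction hypotheses put every ordinal
    member of each into the other, individuals of 0 belong to both, and so the two are equal after
    all. *)
Lemma ordinal_trichotomy (a b : M) : ordinal a -> ordinal b -> a ∈ b \/ a = b \/ b ∈ a.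
Proof using hM ext.
  intros Ha; revert b; revert a Ha; ordinal_induction; intros a Ha IHa.
  ordinal_induction; intros b Hb IHb.
  apply NNPP; intros C.
  apply C; right; left; apply ext; intros u; split; intros Hu.
  - destruct (ordinal_mem_cases Ha Hu) as [Z|Ou]; [now apply zero_subset|].
    destruct (IHa u Hu Ou b Hb) as [H|[->|H]]; auto; exfalso; eauto using ordinal_trans.
  - destruct (ordinal_mem_cases Hb Hu) as [Z|Ou]; [now apply zero_subset|].
    destruct (IHb u Hu Ou) as [H|[->|H]]; auto; exfalso; eauto using ordinal_trans.
Qed.

Lemma ordinal_succ (b : M) : ordinal b -> ordinal (succ b).
Proof using hM ext.
  intros Hb; pose proof Hb as Hb'; apply ordinalE in Hb as [H1 [H2 [H3 H4]]].
  rewrite ordinalE; repeat split.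
  - rewrite in_succ; intros [H|H].
    + apply H1. apply (ordinal_trans Hb' H). rewrite in_succ; auto.
    + apply H1. rewrite <- H at 2. rewrite in_succ; auto.
  - intros u Hu w Hw. rewrite in_succ in *. destruct Hu as [Hu| ->]; eauto using ordinal_trans.
  - intros u; rewrite in_succ; intros [Hu| ->]; auto.
  - intros u; rewrite in_succ; intros [Hu| ->]; auto.
Qed.

Lemma succ_subset (b c u : M) : ordinal c -> b ∈ c -> u ∈ succ b -> u ∈ c.
Proof using hM ext.
  intros Hc Hb; rewrite in_succ; intros [Hu| ->]; eauto using ordinal_trans.
Qed.

Lemma succ_mem_cases (b c : M) : ordinal b -> ordinal c -> b ∈ c -> succ b ∈ c \/ succ b = c.
Proof using hM ext.
  intros Hb Hc Hbc; destruct (ordinal_trichotomy (ordinal_succ Hb) Hc) as [H|[H|H]]; auto.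
  exfalso. apply (ordinal_irrefl Hc). now apply (succ_subset Hc Hbc).
Qed.

Lemma succ_inj (b c : M) : ordinal b -> ordinal c -> succ b = succ c -> b = c.
Proof using hM ext.
  intros Hb Hc H.
  assert (K : b ∈ succ c) by (rewrite <- H, in_succ; auto).
  assert (L : c ∈ succ b) by (rewrite H, in_succ; auto).
  rewrite in_succ in K, L. destruct K as [K|K], L as [L|L]; auto.
  exfalso; eauto using ordinal_trans, ordinal_irrefl.
  exfalso; apply (ordinal_irrefl Hb). now apply (ordinal_trans Hb L).
Qed.

Lemma succ_not_zero (b : M) : ordinal b -> succ b <> zero.
Proof using hM ext.
  intros Hb H.
  assert (K : b ∈ zero) by (rewrite <- H, in_succ; auto).
  now apply (ordinal_irrefl Hb), zero_individual.
Qed.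

Lemma bigcup_succ b : ordinal b -> bigcup (succ b) = b.
Proof using hM ext.
  intros Hb; apply ext; intros u; rewrite in_bigcup; split.
  - intros [w [Hw Hu]]; apply in_succ in Hw as [Hw| ->]; eauto using ordinal_trans.
  - intros Hu; exists b; rewrite in_succ; auto.
Qed.

Lemma naturalE (s : M) : natural s <->
  s ∉ s /\ transitive s /\ (forall u, u ∈ s -> transitive u) /\
  (forall u, u ∈ succ s -> u ∈ zero \/ u = zero \/ bigcup u ∈ u).
Proof using hM ext.
  unfold natural, transitive_set_with_transitive_members, individual; split.
  - intros [[H1 [H2 H3]] [_ H4]]; repeat split; auto.
    intros u Hu. destruct (H4 (succ s) u) as [K|[v [Hv K]]]; auto.
    + now apply is_succE.
    + apply in_succ_zeroE in K; tauto.
    + apply is_bigcupE in Hv as ->; auto.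
  - intros [H1 [H2 [H3 H4]]]; repeat split; auto.
    + rewrite in_zeroE; intros H; apply H1; now apply zero_individual.
    + intros s1 u Hs Hu; apply is_succE in Hs as ->.
      rewrite in_succ_zeroE. destruct (H4 u Hu) as [K|[K|K]]; auto.
      right; exists (bigcup u); now rewrite is_bigcupE.
Qed.

Lemma natural_mem (n u : M) : natural n -> u ∈ n -> u ∉ u -> natural u.
Proof using hM ext.
  rewrite !naturalE; intros [H1 [H2 [H3 H4]]] Hu Nu; repeat split; auto.
  - intros w Hw; apply H3; now apply (H2 u).
  - intros w; rewrite in_succ; intros Hw; apply H4; rewrite in_succ; left.
    destruct Hw as [Hw| ->]; auto; now apply (H2 u).
Qed.

(** The definition, applied to [n] itself, gives ⋃n ∈ n. If p = ⋃n were an individual, every member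
    of [n] would have p as its only member and so equal p; then [n] would equal p and be an
    individual. *)
Lemma natural_pred (n : M) : natural n -> n <> zero ->
  natural (bigcup n) /\ bigcup n ∈ n.
Proof using hM ext.
  intros Hn Z. pose proof Hn as Hn'; apply naturalE in Hn as [H1 [H2 [H3 H4]]].
  destruct (H4 n) as [H|[H|H]]; [now rewrite in_succ; right| |tauto|].
  - exfalso; now apply H1, zero_individual.
  - split; auto. apply (natural_mem Hn'); auto. intros I.
    apply H1. replace n with (bigcup n); auto. apply ext; intros u.
    rewrite (in_individual _ I); split; [intros ->; exact H|]. intros Hu.
    destruct (nonempty u) as [w Hw].
    assert (K : forall w, w ∈ u -> w = bigcup n)
      by (intros w' Hw'; apply (in_individual _ I), in_bigcup; eauto).
    apply ext; intros x; rewrite (in_individual _ I); split; auto.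
    intros ->; now rewrite <- (K w).
Qed.

(** An individual member u of [n] satisfies u ∈ u ∈ n, hence lies in ⋃n, which is an ordinal by
    induction; so u belongs to 0. *)
Lemma natural_ordinal (n : M) : natural n -> ordinal n.
Proof using hM ext.
  intros Hn. pose proof Hn as Hn'. apply naturalE in Hn' as [H1 [H2 [H3 _]]].
  revert Hn; revert n H1 H2 H3.
  apply (@trans_ind (fun n => natural n -> ordinal n)); [definable_tac|].
  intros n H1 H2 H3 IH Hn.
  destruct (classic (n = zero)) as [->|Z]; [apply ordinal_zero|].
  destruct (natural_pred Hn Z) as [Hp Kp].
  assert (Op : ordinal (bigcup n)).
  { apply IH; auto. now apply naturalE in Hp. }
  rewrite ordinalE; repeat split; auto.
  intros u Hu Iu. apply ordinalE in Op; apply Op; auto. apply in_bigcup; eauto.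
Qed.

(** The predecessor is ⋃n: if its successor were still a member of [n], then ⋃n would be a member of
    itself. *)
Lemma natural_cases (n : M) : natural n -> n = zero \/ exists k, natural k /\ n = succ k.
Proof using hM ext.
  intros Hn; destruct (classic (n = zero)) as [->|Z]; auto; right.
  destruct (natural_pred Hn Z) as [Hp Kp]; exists (bigcup n); split; auto.
  apply natural_ordinal in Hn, Hp.
  destruct (succ_mem_cases Hp Hn Kp) as [H|H]; auto.
  exfalso; apply (ordinal_irrefl Hp), in_bigcup; exists (succ (bigcup n)).
  rewrite in_succ; auto.
Qed.

Lemma natural_zero : natural zero.
Proof using hM ext.
  pose proof ordinal_zero as H; apply ordinalE in H as [H1 [H2 [H3 H4]]].
  apply naturalE; repeat split; auto. intros u; rewrite in_succ; tauto.
Qed.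

Lemma natural_succ (n : M) : natural n -> natural (succ n).
Proof using hM ext.
  intros Hn; pose proof (natural_ordinal Hn) as On.
  pose proof (ordinal_succ On) as Os; apply ordinalE in Os as [H1 [H2 [H3 H4]]].
  apply naturalE; repeat split; auto. intros u Hu; apply in_succ in Hu as [Hu| ->].
  - apply naturalE in Hn; now apply Hn.
  - right; right. rewrite bigcup_succ, in_succ; auto.
Qed.

Lemma natural_ind (P : M -> Prop) : definable 1 (fun r => P (r 0)) ->
  P zero -> (forall n, natural n -> P n -> P (succ n)) -> forall n, natural n -> P n.
Proof using hM ext.
  intros D P0 PS n Hn. pose proof (natural_ordinal Hn) as On. revert Hn.
  revert n On; ordinal_induction; intros n On IH Hn.
  destruct (natural_cases Hn) as [->|[k [Hk ->]]]; auto.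
  apply PS; auto. apply IH; auto using natural_ordinal. rewrite in_succ; auto.
Qed.

Ltac natural_induction :=
  match goal with |- forall n, natural n -> @?P n =>
    apply (@natural_ind P); [definable_tac| |]; cbv beta end.

Lemma natural_succ_inj (k l : M) : natural k -> natural l -> succ k = succ l -> k = l.
Proof using hM ext. auto using succ_inj, natural_ordinal. Qed.

Lemma natural_succ_not_zero (k : M) : natural k -> succ k <> zero.
Proof using hM ext. auto using succ_not_zero, natural_ordinal. Qed.

(** * The sets F^m_u *)

(** Tuples as relations rather than terms, which is the form that definability requires. *)
Definition is_tuple3 (a b c t : M) : Prop := exists p, is_opair a b p /\ is_opair p c t.
Definition is_tuple4 (a b c d t : M) : Prop := exists p, is_tuple3 a b c p /\ is_opair p d t.

Lemma is_tuple3E a b c t : is_tuple3 a b c t <-> t = tuple3 a b c.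
Proof using hM ext.
  unfold is_tuple3, tuple3; split.
  - intros [p [Hp Ht]]; apply is_opairE in Hp as ->; now apply is_opairE.
  - intros ->; exists (opair a b); now rewrite !is_opairE.
Qed.

Lemma is_tuple4E a b c d t : is_tuple4 a b c d t <-> t = tuple4 a b c d.
Proof using hM ext.
  unfold is_tuple4, tuple4; split.
  - intros [p [Hp Ht]]; apply is_tuple3E in Hp as ->; now apply is_opairE.
  - intros ->; exists (tuple3 a b c); now rewrite is_tuple3E, is_opairE.
Qed.

Lemma definable_is_tuple3 n (a b c t : (nat -> M) -> M) :
  simple_term n a -> simple_term n b -> simple_term n c -> simple_term n t ->
  definable n (fun r => is_tuple3 (a r) (b r) (c r) (t r)).
Proof using. apply definable_subst4; unfold is_tuple3; definable_tac. Qed.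
Hint Resolve definable_is_tuple3 : definable.

Lemma definable_is_tuple4 n (a b c d t : (nat -> M) -> M) :
  simple_term n a -> simple_term n b -> simple_term n c -> simple_term n d ->
  simple_term n t ->
  definable n (fun r => is_tuple4 (a r) (b r) (c r) (d r) (t r)).
Proof using. apply definable_subst5; unfold is_tuple4; definable_tac. Qed.
Hint Resolve definable_is_tuple4 : definable.

Lemma tuple3_separation (R : M -> M -> M -> Prop) A B C :
  definable 3 (fun r => R (r 0) (r 1) (r 2)) ->
  (exists a b c, a ∈ A /\ b ∈ B /\ c ∈ C /\ R a b c) ->
  exists S, forall a b c, in3 S a b c <-> a ∈ A /\ b ∈ B /\ c ∈ C /\ R a b c.
Proof using hM ext.
  intros D [a0 [b0 [c0 [Ha [Hb [Hc HR]]]]]].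
  destruct (product_exists A B) as [AB HAB], (product_exists AB C) as [X HX].
  destruct (@separation (fun t => exists a b c, (a ∈ A /\ b ∈ B /\ c ∈ C /\ R a b c) /\
    is_tuple3 a b c t) X) as [S HS].
  - definable_tac. apply definable_subst3; [auto|simple_term_tac..].
  - exists (tuple3 a0 b0 c0); split; [now apply HX; [apply HAB|]|].
    exists a0, b0, c0; now rewrite is_tuple3E.
  - exists S; intros a b c; rewrite in3E, HS; split.
    + intros [_ [a' [b' [c' [H K]]]]]; apply is_tuple3E, tuple3_inj in K.
      now destruct K as [-> [-> ->]].
    + intros [H1 [H2 [H3 H4]]]; split; [now apply HX; [apply HAB|]|].
      exists a, b, c; now rewrite is_tuple3E.
Qed.

(** The justification of a single tuple from [S], detached from [F_computation] so that it can be
    asserted of a tuple not yet in [S]. *)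
Definition F_clause (S m u x : M) : Prop :=
  natural m /\ (ordinal u \/ in_zero u) /\
  ((is_zero m /\ eqs x u) \/
   (exists k y : M, natural k /\ is_succ k m /\ in3 S k u y /\
      (forall v : M, v ∈ y -> exists z : M, in3 S k v z) /\
      (forall v : M, v ∈ x <->
         v ∈ y /\ exists z : M, in3 S k v z /\ is_bigcup z v))).

Lemma definable_F_clause n (a b c d : (nat -> M) -> M) :
  simple_term n a -> simple_term n b -> simple_term n c -> simple_term n d ->
  definable n (fun r => F_clause (a r) (b r) (c r) (d r)).
Proof using. apply definable_subst4; unfold F_clause; definable_tac. Qed.
Hint Resolve definable_F_clause : definable.

Lemma F_clause_zero S u x : F_clause S zero u x -> x = u.
Proof using hM ext.
  intros [_ [_ [[_ H]|[k [y [Hk [Hs _]]]]]]]; [now apply eqs_eq|].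
  apply is_succE in Hs; symmetry in Hs; now apply natural_succ_not_zero in Hs.
Qed.

Lemma F_clause_succ S k u x : natural k -> F_clause S (succ k) u x ->
  exists y, in3 S k u y /\ (forall v, v ∈ y -> exists z, in3 S k v z) /\
    (forall v, v ∈ x <-> v ∈ y /\ exists z, in3 S k v z /\ is_bigcup z v).
Proof using hM ext.
  intros Nk [_ [_ [[Hz _]|[k' [y [Hk' [Hs H]]]]]]].
  - apply is_zeroE in Hz; now apply natural_succ_not_zero in Hz.
  - apply is_succE, natural_succ_inj in Hs as <-; eauto.
Qed.

(** Induction on [m]. The clause demands a value for every member of y, so whatever one computation
    knows about such a member has a counterpart in the other, equal to it by the induction
    hypothesis. *)
Lemma F_clause_unique (m : M) : natural m -> forall S S' u x x',
  F_computation S -> F_computation S' ->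
  F_clause S m u x -> F_clause S' m u x' -> x = x'.
Proof using hM ext.
  revert m; natural_induction.
  - intros S S' u x x' _ _ H H'; apply F_clause_zero in H, H'; congruence.
  - intros m Nm IH S S' u x x' HS HS' H H'.
    apply F_clause_succ in H as [y [Hy [Ty Hx]]], H' as [y' [Hy' [Ty' Hx']]]; auto.
    assert (U : forall v z z', in3 S m v z -> in3 S' m v z' -> z = z').
    { intros v z z' Hz Hz'; apply (IH S S' v z z'); auto; [now apply HS|now apply HS']. }
    rewrite <- (U _ _ _ Hy Hy') in *; clear y' Hy'.
    apply ext; intros v; rewrite Hx, Hx'; split; intros [Hv [z [Hz Kz]]]; split; auto.
    + destruct (Ty' v Hv) as [z' Hz']; pose proof (U _ _ _ Hz Hz') as <-; eauto.
    + destruct (Ty v Hv) as [z' Hz']; pose proof (U _ _ _ Hz' Hz) as <-; eauto.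
Qed.

Lemma is_F_unique (m u x x' : M) : is_F m u x -> is_F m u x' -> x = x'.
Proof using hM ext.
  intros [S [HS H]] [S' [HS' H']].
  assert (K := HS _ _ _ H). assert (K' := HS' _ _ _ H').
  apply (F_clause_unique (proj1 K) HS HS' K K').
Qed.

(** A larger set might contain further values for the same arguments and so alter the last clause.
    Each tuple of [C] being justified by some computation, [F_clause_unique] identifies such values
    with those already in [S]. *)
Lemma F_computation_closure (C : M) :
  (forall m u x, in3 C m u x -> exists S, F_computation S /\
     (forall k v z, in3 S k v z -> in3 C k v z) /\ F_clause S m u x) ->
  F_computation C.
Proof using hM ext.
  intros HC m u x H; destruct (HC _ _ _ H) as [S [HS [HSC [Nm [Hu K]]]]].
  split; [auto|split; [auto|]].
  destruct K as [K|[k [y [Nk [Hs [Hy [Ty Hx]]]]]]]; auto.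
  right; exists k, y; split; [auto|split; [auto|split; [auto|split]]].
  - intros v Hv; destruct (Ty v Hv) as [z Hz]; eauto.
  - intros v; rewrite Hx; split; intros [Hv [z [Hz Kz]]]; split; eauto.
    destruct (Ty v Hv) as [z' Hz']; exists z'; split; auto.
    replace z' with z; auto.
    destruct (HC _ _ _ Hz) as [S' [HS' [_ L]]].
    exact (F_clause_unique Nk HS' HS L (HS _ _ _ Hz')).
Qed.

Lemma in3_cup S S' a b c : in3 (cup S S') a b c <-> in3 S a b c \/ in3 S' a b c.
Proof using hM ext. now rewrite !in3E, in_cup. Qed.

Lemma bigcup_individual (a : M) : a ∈ a -> is_bigcup a a.
Proof using hM ext.
  intros I u; split; [eauto|]. intros [w [Hw Hu]].
  now apply (in_individual _ I) in Hw as ->.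
Qed.

(* Carrying the individuals along keeps the sets F^m_u nonempty, as separation
   demands. *)
Lemma F_computation_exists (T : M) :
  transitive T -> (forall u, u ∈ T -> ordinal u \/ u ∈ zero) ->
  forall m, natural m -> exists S, F_computation S /\
    forall u, u ∈ T -> exists x, in3 S m u x /\ subs x u /\
      (forall a, a ∈ u -> a ∈ zero -> a ∈ x).
Proof using hM ext.
  intros TT HT. natural_induction.
  - destruct (nonempty T) as [t Ht].
    destruct (@tuple3_separation (fun m u x => m = zero /\ u = x) (pr zero zero) T T)
      as [S HS].
    + definable_tac.
    + exists zero, t, t; rewrite in_pr; tauto.
    + exists S; split.
      * intros m u x H; apply HS in H as [_ [Hu [_ [-> ->]]]].
        split; [apply natural_zero|]. rewrite in_zeroE; split; [now apply HT|].
        left; now rewrite is_zeroE.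
      * intros u Hu; exists u; split; [|split; auto; now intros w].
        apply HS; rewrite in_pr; auto.
  - intros m Nm [S [HS KS]].
    assert (E : forall u, u ∈ T -> exists x, F_clause S (succ m) u x /\ subs x u /\
      (forall a, a ∈ u -> a ∈ zero -> a ∈ x)).
    { intros u Hu; destruct (KS u Hu) as [y [Hy [Sy Iy]]].
      (* For an individual a the value F^m_a is a subset of a containing a, hence a itself; thus a
         survives into the next stage. *)
      assert (J : forall a, a ∈ u -> a ∈ zero ->
        a ∈ y /\ exists z, in3 S m a z /\ is_bigcup z a).
      { intros a Ha Za; split; auto. pose proof (zero_individual Za) as I.
        destruct (KS a) as [z [Hz [Sz Iz]]]; [now apply (TT u)|].
        exists z; split; auto. replace z with a; [now apply bigcup_individual|].
        apply ext; intros w; rewrite (in_individual _ I); split.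
        - intros ->; auto.
        - intros Hw; now apply (in_individual _ I), Sz. }
      destruct (@separation (fun v => exists z, in3 S m v z /\ is_bigcup z v) y)
        as [x Hx].
      - definable_tac.
      (* The witness for separation is o if [u] is an ordinal, and [u] itself if it is an
         individual. *)
      - destruct (HT u Hu) as [O|Z].
        + exists o; apply J; [apply zero_subset; auto|]; apply in_zeroset; auto.
        + exists u; apply J; auto using zero_individual.
      - exists x; split; [|split].
        + split; [now apply natural_succ|]. rewrite in_zeroE; split; [now apply HT|].
          right; exists m, y; rewrite is_succE.
          split; [auto|split; [auto|split; [auto|split; [|exact Hx]]]].
          intros v Hv; destruct (KS v) as [z [Hz _]]; eauto. apply (TT u); auto.
        + intros v Hv; apply Sy; now apply Hx.
        + intros a Ha Za; apply Hx; now apply J. }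
    destruct (power_exists T) as [P HP].
    (* The new stage is separated from {m+1} × T × P, where P is the power set of T: the values are
       subsets of members of the transitive set T. *)
    destruct (@tuple3_separation (fun m' u x => F_clause S m' u x)
      (pr (succ m) (succ m)) T P) as [S' HS'].
    + definable_tac.
    + destruct (nonempty T) as [u Hu]; destruct (E u Hu) as [x [Hx [Sx _]]].
      exists (succ m), u, x; rewrite in_pr, HP.
      split; [auto|split; [auto|split; [|auto]]]. intros w Hw; apply (TT u); auto.
    + exists (cup S S'); split.
      * apply F_computation_closure; intros k u x H; exists S; split; auto.
        split; [intros; rewrite in3_cup; auto|].
        apply in3_cup in H as [H|H]; [now apply HS|]. now apply HS' in H.
      * intros u Hu; destruct (E u Hu) as [x [Hx [Sx Ix]]]; exists x; split; auto.
        apply in3_cup; right; apply HS'; rewrite in_pr, HP.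
        split; [auto|split; [auto|split; [|auto]]]. intros w Hw; apply (TT u); auto.
Qed.

Lemma is_F_exists (m u : M) : natural m -> ordinal u \/ u ∈ zero ->
  exists x, is_F m u x /\ subs x u.
Proof using hM ext.
  intros Nm Hu.
  assert (E : exists b, ordinal b /\ u ∈ succ b).
  { destruct Hu as [O|Z]; [exists u|exists zero]; rewrite in_succ;
      auto using ordinal_zero. }
  destruct E as [b [Ob Hb]].
  destruct (@F_computation_exists (succ b)) with (m := m) as [S [HS KS]]; auto.
  - apply ordinal_succ, ordinalE in Ob; tauto.
  - intros v Hv; apply or_comm, (ordinal_mem_cases (ordinal_succ Ob) Hv).
  - destruct (KS u Hb) as [x [Hx [Sx _]]]; exists x; split; auto. now exists S.
Qed.

Lemma is_F_domain (m u x : M) : is_F m u x -> natural m /\ (ordinal u \/ u ∈ zero).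
Proof using hM ext.
  intros [S [HS H]]; apply HS in H as [Nm [Hu _]]; now rewrite in_zeroE in Hu.
Qed.

Lemma is_F_subset (m u x : M) : is_F m u x -> subs x u.
Proof using hM ext.
  intros H; destruct (is_F_domain H) as [Nm Hu].
  destruct (is_F_exists Nm Hu) as [x' [H' Sx]]. now rewrite (is_F_unique H H').
Qed.

Lemma is_F_zero (u x : M) : is_F zero u x -> x = u.
Proof using hM ext.
  intros [S [HS H]]; now apply HS, F_clause_zero in H.
Qed.

Lemma is_F_succ (m u x : M) : is_F (succ m) u x -> natural m ->
  exists y, is_F m u y /\ (forall v, v ∈ x <-> v ∈ y /\ bigcup_F_eq m v).
Proof using hM ext.
  intros [S [HS H]] Nm; apply HS, F_clause_succ in H as [y [Hy [Ty Hx]]]; auto.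
  exists y; split; [now exists S|]. intros v; rewrite Hx; split.
  - intros [Hv [z [Hz Kz]]]; split; auto. exists z; split; auto. now exists S.
  - intros [Hv [z [Hz Kz]]]; split; auto. destruct (Ty v Hv) as [z' Hz'].
    exists z'; split; auto. replace z' with z; auto.
    apply (is_F_unique Hz); now exists S.
Qed.

Lemma ordinal_or_individual_trans (u v w : M) :
  ordinal u \/ u ∈ zero -> v ∈ u -> w ∈ v -> w ∈ u.
Proof using hM ext.
  intros [H|H]; [eauto using ordinal_trans|].
  intros Hv; apply (individual_transitive (zero_individual H) Hv).
Qed.

(** F^{m+1}_u ⊆ F^m_u ⊆ u, and [u] is transitive, so the union of the middle set is caught between
    [u] and [u]. *)
Lemma bigcup_F_eq_pred (m u : M) : natural m -> bigcup_F_eq (succ m) u -> bigcup_F_eq m u.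
Proof using hM ext.
  intros Nm [x [Hx Ex]]; destruct (is_F_succ Hx Nm) as [y [Hy Hxy]].
  exists y; split; auto. intros w; split.
  - intros Hw; apply Ex in Hw as [v [Hv Hw]]; exists v; split; auto; now apply Hxy.
  - intros [v [Hv Hw]]. pose proof (is_F_domain Hy) as [_ Hu].
    now apply (ordinal_or_individual_trans Hu (is_F_subset Hy Hv)).
Qed.

(* For m = l + 1 this says v ∈ F^{l+1}, i.e. ⋃F^l_v = v; for m = 0 it is empty. *)
Definition F_member (m v : M) : Prop :=
  forall l, natural l -> is_succ l m -> bigcup_F_eq l v.

Lemma definable_F_member n (a b : (nat -> M) -> M) :
  simple_term n a -> simple_term n b -> definable n (fun r => F_member (a r) (b r)).
Proof using. apply definable_subst2; unfold F_member; definable_tac. Qed.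
Hint Resolve definable_F_member : definable.

Lemma F_member_zero (v : M) : F_member zero v.
Proof using hM ext.
  intros l Nl Hl; apply is_succE in Hl; symmetry in Hl.
  now apply natural_succ_not_zero in Hl.
Qed.

Lemma F_member_succ (m v : M) : natural m -> F_member (succ m) v <-> bigcup_F_eq m v.
Proof using hM ext.
  intros Nm; split.
  - intros H; apply H; auto. now apply is_succE.
  - intros H l Nl Hl; now apply is_succE, natural_succ_inj in Hl as <-.
Qed.

Lemma bigcup_F_eq_member (m u : M) : natural m -> bigcup_F_eq m u -> F_member m u.
Proof using hM ext.
  intros Nm H; destruct (natural_cases Nm) as [->|[k [Nk ->]]].
  - apply F_member_zero.
  - now apply F_member_succ, bigcup_F_eq_pred.
Qed.

(** The conditions accumulated along the recursion collapse to the last one, by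
    [bigcup_F_eq_pred]. *)
Lemma in_F (m : M) : natural m -> forall u x, is_F m u x ->
  forall v, v ∈ x <-> v ∈ u /\ F_member m v.
Proof using hM ext.
  revert m; natural_induction.
  - intros u x Hx v; rewrite (is_F_zero Hx). pose proof (F_member_zero v); tauto.
  - intros m Nm IH u x Hx v; destruct (is_F_succ Hx Nm) as [y [Hy Hxy]].
    rewrite Hxy, (IH u y Hy), F_member_succ; auto.
    pose proof (@bigcup_F_eq_member m v Nm); tauto.
Qed.

(** From here on computations of F^m can be forgotten. Only one inclusion has to be stated, the
    other being transitivity. *)
Lemma bigcup_F_eqE (m u : M) : natural m -> ordinal u \/ u ∈ zero ->
  bigcup_F_eq m u <->
  forall w, w ∈ u -> exists v, v ∈ u /\ F_member m v /\ w ∈ v.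
Proof using hM ext.
  intros Nm Hu; split.
  - intros [x [Hx Ex]] w Hw; apply Ex in Hw as [v [Hv Hw]].
    exists v; apply (in_F Nm Hx) in Hv; tauto.
  - intros H; destruct (is_F_exists Nm Hu) as [x [Hx Sx]]; exists x; split; auto.
    intros w; split.
    + intros Hw; destruct (H w Hw) as [v [Hv [Fv Kv]]]; exists v; split; auto.
      now apply (in_F Nm Hx).
    + intros [v [Hv Hw]]; now apply (ordinal_or_individual_trans Hu (Sx v Hv)).
Qed.

Lemma bigcup_F_eq_individual (a : M) : a ∈ zero -> forall m, natural m -> bigcup_F_eq m a.
Proof using hM ext.
  intros Za; pose proof (zero_individual Za) as I; natural_induction.
  - apply bigcup_F_eqE; auto using natural_zero.
    intros w Hw; exists a; auto using F_member_zero.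
  - intros m Nm H; apply bigcup_F_eqE; auto using natural_succ.
    intros w Hw; exists a; rewrite F_member_succ; auto.
Qed.

Lemma F_member_individual (a m : M) : a ∈ zero -> natural m -> F_member m a.
Proof using hM ext. intros; now apply bigcup_F_eq_member, bigcup_F_eq_individual. Qed.

Lemma bigcup_F_eq_zero (m : M) : natural m -> bigcup_F_eq m zero.
Proof using hM ext.
  intros Nm; apply bigcup_F_eqE; auto using ordinal_zero.
  intros w Hw; exists w; auto using F_member_individual, zero_individual.
Qed.

(** * The terms α + ω^m·n *)

Lemma tuple4_separation (R : M -> M -> M -> M -> Prop) A B C D :
  definable 4 (fun r => R (r 0) (r 1) (r 2) (r 3)) ->
  (exists a b c d, a ∈ A /\ b ∈ B /\ c ∈ C /\ d ∈ D /\ R a b c d) ->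
  exists S, forall a b c d, in4 S a b c d <->
    a ∈ A /\ b ∈ B /\ c ∈ C /\ d ∈ D /\ R a b c d.
Proof using hM ext.
  intros Df [a0 [b0 [c0 [d0 [Ha [Hb [Hc [Hd HR]]]]]]]].
  destruct (product_exists A B) as [AB HAB], (product_exists AB C) as [ABC HABC],
    (product_exists ABC D) as [X HX].
  destruct (@separation (fun t => exists a b c d,
    (a ∈ A /\ b ∈ B /\ c ∈ C /\ d ∈ D /\ R a b c d) /\ is_tuple4 a b c d t) X) as [S HS].
  - definable_tac. apply definable_subst4; [auto|simple_term_tac..].
  - exists (tuple4 a0 b0 c0 d0); split; [now apply HX; [apply HABC; [apply HAB|]|]|].
    exists a0, b0, c0, d0; now rewrite is_tuple4E.
  - exists S; intros a b c d; rewrite in4E, HS; split.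
    + intros [_ [a' [b' [c' [d' [H K]]]]]]; apply is_tuple4E, tuple4_inj in K.
      now destruct K as [-> [-> [-> ->]]].
    + intros [H1 [H2 [H3 [H4 H5]]]]; split; [now apply HX; [apply HABC; [apply HAB|]|]|].
      exists a, b, c, d; now rewrite is_tuple4E.
Qed.

Definition omega_clause (S m a n y : M) : Prop :=
  natural m /\ ordinal a /\ natural n /\
  (is_zero m \/
   exists l : M, natural l /\ is_succ l m /\ first_omega_number l a) /\
  ((is_zero n /\ eqs y a) \/
   (exists k z : M, natural k /\ is_succ k n /\ in4 S m a k z /\ omega_step S m z y)).

Lemma definable_omega_clause n (a b c d e : (nat -> M) -> M) :
  simple_term n a -> simple_term n b -> simple_term n c -> simple_term n d ->
  simple_term n e ->
  definable n (fun r => omega_clause (a r) (b r) (c r) (d r) (e r)).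
Proof using. apply definable_subst5; unfold omega_clause; definable_tac. Qed.
Hint Resolve definable_omega_clause : definable.

Lemma omega_clause_zero S m a y : omega_clause S m a zero y -> y = a.
Proof using hM ext.
  intros [_ [_ [_ [_ [[_ H]|[k [z [Hk [Hs _]]]]]]]]]; [now apply eqs_eq|].
  apply is_succE in Hs; symmetry in Hs; now apply natural_succ_not_zero in Hs.
Qed.

Lemma omega_clause_succ S m a k y : natural k -> omega_clause S m a (succ k) y ->
  exists z, in4 S m a k z /\ omega_step S m z y.
Proof using hM ext.
  intros Nk [_ [_ [_ [_ [[Hz _]|[k' [z [Hk' [Hs H]]]]]]]]].
  - apply is_zeroE in Hz; now apply natural_succ_not_zero in Hz.
  - apply is_succE, natural_succ_inj in Hs as <-; eauto.
Qed.

Lemma omega_step_zero S z y : omega_step S zero z y -> y = succ z.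
Proof using hM ext.
  intros [[_ H]|[l [Nl [Hs _]]]]; [now apply is_succE|].
  apply is_succE in Hs; symmetry in Hs; now apply natural_succ_not_zero in Hs.
Qed.

Lemma omega_step_succ S l z y : natural l -> omega_step S (succ l) z y ->
  (forall i, natural i -> exists x, in4 S l z i x) /\
  (forall u, u ∈ y <-> exists i x, natural i /\ in4 S l z i x /\ u ∈ x).
Proof using hM ext.
  intros Nl [[Hz _]|[l' [Nl' [Hs [_ H]]]]].
  - apply is_zeroE in Hz; now apply natural_succ_not_zero in Hz.
  - now apply is_succE, natural_succ_inj in Hs as <-.
Qed.

(** Induction on [m], and on [n] for fixed [m]. The base [a] stays general because a step from z at
    level l + 1 consults the terms z + ω^l·i, whose base is z. *)
Lemma omega_clause_unique (m : M) : natural m -> forall S S',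
  omega_computation S -> omega_computation S' -> forall n, natural n -> forall a y y',
  omega_clause S m a n y -> omega_clause S' m a n y' -> y = y'.
Proof using hM ext.
  assert (inner : forall m, natural m -> forall S S',
    omega_computation S -> omega_computation S' ->
    (forall z y y', omega_step S m z y -> omega_step S' m z y' -> y = y') ->
    forall n, natural n -> forall a y y',
    omega_clause S m a n y -> omega_clause S' m a n y' -> y = y').
  { intros m' Nm S S' HS HS' step. natural_induction.
    - intros a y y' H H'; apply omega_clause_zero in H, H'; congruence.
    - intros n Nn IH a y y' H H'.
      apply omega_clause_succ in H as [z [Hz Hy]], H' as [z' [Hz' Hy']]; auto.
      replace z' with z in Hy'; [now apply (step z)|].
      apply (IH a); [now apply HS|now apply HS']. }
  revert m; natural_induction.
  - intros S S' HS HS'; apply inner; auto using natural_zero.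
    intros z y y' H H'; apply omega_step_zero in H, H'; congruence.
  - intros m Nm IH S S' HS HS'; apply inner; auto using natural_succ.
    intros z y y' H H'.
    apply omega_step_succ in H as [Ty Hy], H' as [Ty' Hy']; auto.
    assert (U : forall i x x', natural i -> in4 S m z i x -> in4 S' m z i x' -> x = x').
    { intros i x x' Ni Hx Hx'.
      apply (IH S S' HS HS' i Ni z); [now apply HS|now apply HS']. }
    apply ext; intros u; rewrite Hy, Hy'; split; intros [i [x [Ni [Hx Hu]]]].
    + destruct (Ty' i Ni) as [x' Hx']; pose proof (U _ _ _ Ni Hx Hx') as <-; eauto.
    + destruct (Ty i Ni) as [x' Hx']; pose proof (U _ _ _ Ni Hx' Hx) as <-; eauto.
Qed.

Lemma is_omega_mul_unique (m a n y y' : M) :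
  is_omega_mul m a n y -> is_omega_mul m a n y' -> y = y'.
Proof using hM ext.
  intros [S [HS H]] [S' [HS' H']].
  pose proof (HS _ _ _ _ H) as K. pose proof (HS' _ _ _ _ H') as K'.
  apply (omega_clause_unique (proj1 K) HS HS' (proj1 (proj2 (proj2 K))) K K').
Qed.

(** All terms that a step consults are subsets of its result, so discarding the tuples that exceed a
    given bound leaves the remaining ones justified. *)
Lemma omega_step_subset (S m z y : M) : omega_computation S -> omega_step S m z y ->
  subs z y /\ (forall l i x, is_succ l m -> natural l -> natural i ->
     in4 S l z i x -> subs x y).
Proof using hM ext.
  intros HS [[Hm Hy]|[l [Nl [Hl [_ [Ty Hy]]]]]].
  - apply is_succE in Hy as ->; split.
    + intros u Hu; rewrite in_succ; auto.
    + intros l i x Hl Nl. apply is_zeroE in Hm as ->; apply is_succE in Hl; symmetry in Hl.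
      now apply natural_succ_not_zero in Hl.
  - apply is_succE in Hl as ->. split.
    + destruct (Ty zero natural_zero) as [x Hx].
      pose proof (omega_clause_zero (HS _ _ _ _ Hx)) as ->.
      intros u Hu; apply Hy; exists zero, z; auto using natural_zero.
    + intros l' i x Hl Nl' Ni Hx. apply is_succE, natural_succ_inj in Hl as <-; auto.
      intros u Hu; apply Hy; eauto.
Qed.

(** Unlike [F_computation_closure], this does not ask [C] to contain all of [S]: the tuples used to
    justify y have values included in y, and their base is [a] or a subset of y. *)
Lemma omega_computation_closure (C : M) :
  (forall m a n y, in4 C m a n y -> exists S, omega_computation S /\
     omega_clause S m a n y /\
     (forall k b i x, in4 S k b i x -> b = a \/ subs b y -> subs x y -> in4 C k b i x)) ->
  omega_computation C.
Proof using hM ext.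
  intros HC m a n y H; destruct (HC _ _ _ _ H) as [S [HS [[Nm [Oa [Nn [Ha K]]]] HSC]]].
  split; [auto|split; [auto|split; [auto|split; [auto|]]]].
  destruct K as [K|[k [z [Nk [Hk [Hz K]]]]]]; auto.
  destruct (omega_step_subset HS K) as [Szy Sxy].
  right; exists k, z; split; [auto|split; [auto|split; [auto|]]].
  destruct K as [K|[l [Nl [Hl [Fz [Ty Hy]]]]]]; [now left|].
  right; exists l; split; [auto|split; [auto|split; [auto|]]].
  assert (I : forall i x, natural i -> in4 S l z i x -> in4 C l z i x).
  { intros i x Ni Hx; apply HSC; auto. exact (Sxy l i x Hl Nl Ni Hx). }
  split.
  - intros i Ni; destruct (Ty i Ni) as [x Hx]; eauto.
  - intros u; rewrite Hy; split; intros [i [x [Ni [Hx Hu]]]]; [now eauto 8|].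
    destruct (Ty i Ni) as [x' Hx']; exists i, x'; split; [auto|split; auto].
    replace x' with x; auto.
    destruct (HC _ _ _ _ Hx) as [S' [HS' [L _]]].
    exact (omega_clause_unique Nl HS' HS Ni L (HS _ _ _ _ Hx')).
Qed.

Lemma in4_cup S S' a b c d : in4 (cup S S') a b c d <-> in4 S a b c d \/ in4 S' a b c d.
Proof using hM ext. now rewrite !in4E, in_cup. Qed.

Lemma omega_computation_cup (S S' : M) :
  omega_computation S -> omega_computation S' -> omega_computation (cup S S').
Proof using hM ext.
  intros HS HS'; apply omega_computation_closure; intros m a n y H.
  apply in4_cup in H as [H|H]; [exists S|exists S']; split; auto;
    (split; [now (apply HS || apply HS')|]); intros; rewrite in4_cup; auto.
Qed.

Lemma is_omega_mul_domain (m a n y : M) : is_omega_mul m a n y ->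
  natural m /\ ordinal a /\ natural n /\
  (is_zero m \/ exists l : M, natural l /\ is_succ l m /\ first_omega_number l a).
Proof using.
  intros [S [HS H]]; apply HS in H; tauto.
Qed.

(** A single tuple is already a computation; [F_member m a] expresses that the base is admissible at
    level [m]. *)
Lemma is_omega_mul_zero (m a : M) : natural m -> ordinal a -> F_member m a ->
  is_omega_mul m a zero a.
Proof using hM ext.
  intros Nm Oa Fa. set (t := tuple4 m a zero a). exists (pr t t); split.
  - intros m' a' n' y' H; apply in4E, in_pr in H.
    assert (K : tuple4 m' a' n' y' = t) by tauto.
    apply tuple4_inj in K as [-> [-> [-> ->]]].
    split; [auto|split; [auto|split; [apply natural_zero|split]]].
    + destruct (natural_cases Nm) as [->|[l [Nl ->]]]; [left; now apply is_zeroE|].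
      right; exists l; rewrite is_succE; split; [auto|split; [auto|split; [auto|]]].
      now apply F_member_succ.
    + left; now rewrite is_zeroE, eqs_eq.
  - rewrite in4E, in_pr; auto.
Qed.

Lemma is_omega_mul_step (S m a k z y : M) : omega_computation S -> in4 S m a k z ->
  omega_step S m z y -> is_omega_mul m a (succ k) y.
Proof using hM ext.
  intros HS H K. set (t := tuple4 m a (succ k) y). exists (cup S (pr t t)); split.
  - apply omega_computation_closure; intros m' a' n' y' H'; exists S; split; [auto|split].
    + apply in4_cup in H' as [H'|H']; [now apply HS|].
      rewrite in4E, in_pr in H'. assert (E : tuple4 m' a' n' y' = t) by tauto.
      apply tuple4_inj in E as [-> [-> [-> ->]]].
      destruct (HS _ _ _ _ H) as [Nm [Oa [Nk [Ha _]]]].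
      split; [auto|split; [auto|split; [now apply natural_succ|split; [auto|]]]].
      right; exists k, z; rewrite is_succE; auto.
    + intros; rewrite in4_cup; auto.
  - apply in4_cup; right; apply in4E, in_pr; auto.
Qed.

Lemma is_omega_mul_zero_succ (a k z : M) :
  is_omega_mul zero a k z -> is_omega_mul zero a (succ k) (succ z).
Proof using hM ext.
  intros [S [HS H]]; apply (is_omega_mul_step HS H). left; now rewrite is_zeroE, is_succE.
Qed.

(* [omega_next l z y] stands for y = z + ω^(l+1). *)
Definition omega_next (l z y : M) : Prop :=
  (forall i, natural i -> exists x, is_omega_mul l z i x) /\
  (forall u, u ∈ y <-> exists i x, natural i /\ is_omega_mul l z i x /\ u ∈ x).

Lemma definable_omega_next n (a b c : (nat -> M) -> M) :
  simple_term n a -> simple_term n b -> simple_term n c ->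
  definable n (fun r => omega_next (a r) (b r) (c r)).
Proof using. apply definable_subst3; unfold omega_next; definable_tac. Qed.
Hint Resolve definable_omega_next : definable.

(* Without replacement, the computations of the terms l, z, i for all i can only
   be united once they are cut down to a fixed set, which W and T bound. *)
Lemma omega_computation_collect (W T m0 a0 n0 y0 : M) :
  (forall i, natural i -> i ∈ W) ->
  is_omega_mul m0 a0 n0 y0 -> subs a0 T -> subs y0 T ->
  exists C, omega_computation C /\
    forall m a n y, is_omega_mul m a n y -> subs a T -> subs y T -> in4 C m a n y.
Proof using hM ext.
  intros HW H0 Sa0 Sy0. destruct (power_exists T) as [P HP].
  assert (N : forall m a n y, is_omega_mul m a n y -> m ∈ W /\ n ∈ W).
  { intros m a n y H; destruct (is_omega_mul_domain H) as [Nm [_ [Nn _]]]; auto. }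
  destruct (@tuple4_separation (fun m a n y => is_omega_mul m a n y) W P W P) as [C HC].
  - definable_tac.
  (* The given term is the witness that separation asks for. *)
  - exists m0, a0, n0, y0. rewrite !HP. destruct (N _ _ _ _ H0); auto 6.
  - exists C; split.
    + apply omega_computation_closure; intros m a n y H.
      apply HC in H as [_ [Ha [_ [Hy [S [HS H]]]]]]; apply HP in Ha, Hy.
      exists S; split; [auto|split; [now apply HS|]].
      intros k b i x K Hb Hx. assert (L : is_omega_mul k b i x) by (now exists S).
      apply HC; rewrite !HP. destruct (N _ _ _ _ L).
      split; [auto|split; [|split; [auto|split; [|auto]]]].
      * destruct Hb as [->|Hb]; auto. intros w Hw; auto.
      * intros w Hw; auto.
    + intros m a n y H Ha Hy; apply HC; rewrite !HP; destruct (N _ _ _ _ H); auto 6.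
Qed.

(** [omega_next] provides a separate computation for each i, while a step needs all the terms z +
    ω^l·i in one set. They are subsets of [y], so they can be collected with [y] as the bound and
    joined to the computation of [z]. *)
Lemma is_omega_mul_succ (W l a k z y : M) :
  (forall i, natural i -> i ∈ W) -> natural l -> ordinal z -> bigcup_F_eq l z ->
  is_omega_mul (succ l) a k z -> omega_next l z y -> is_omega_mul (succ l) a (succ k) y.
Proof using hM ext.
  intros HW Nl Oz Fz [S [HS H]] [Ty Hy].
  assert (H0 : is_omega_mul l z zero z)
    by (apply is_omega_mul_zero; auto; now apply bigcup_F_eq_member).
  assert (Sz : subs z y).
  { intros u Hu; apply Hy; exists zero, z; auto using natural_zero. }
  destruct (omega_computation_collect HW H0 Sz Sz) as [C [HC KC]].
  pose proof (omega_computation_cup HS HC) as HSC.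
  assert (I : forall i x, natural i -> is_omega_mul l z i x -> in4 (cup S C) l z i x).
  { intros i x Ni Hx; apply in4_cup; right; apply KC; auto.
    intros u Hu; apply Hy; eauto. }
  apply (is_omega_mul_step (k := k) (z := z) HSC); [apply in4_cup; auto|].
  right; exists l; rewrite is_succE; split; [auto|split; [auto|split; [now split|split]]].
  - intros i Ni; destruct (Ty i Ni) as [x Hx]; eauto.
  - intros u; rewrite Hy; split; intros [i [x [Ni [Hx Hu]]]]; [eauto 6|].
    exists i, x; split; [auto|split; [|auto]]. now exists (cup S C).
Qed.

(** * Decomposition of first ω^m-numbers *)

Lemma ordinal_of_mem (g v w : M) : ordinal g -> v ∈ g -> w ∈ v -> ordinal w -> ordinal v.
Proof using hM ext.
  intros Og Hv Hw Ow; apply (ordinal_mem Og Hv); intros I.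
  apply (in_individual _ I) in Hw as ->. now apply (ordinal_irrefl Ow).
Qed.

Lemma limit_succ (m g b : M) : natural m -> ordinal g -> bigcup_F_eq m g ->
  ordinal b -> b ∈ g -> succ b ∈ g.
Proof using hM ext.
  intros Nm Og Lg Ob Hb.
  destruct (proj1 (bigcup_F_eqE Nm (or_introl Og)) Lg b Hb) as [v [Hv [_ Kv]]].
  pose proof (ordinal_of_mem Og Hv Kv Ob) as Ov.
  destruct (succ_mem_cases Ob Ov Kv) as [H|<-]; eauto using ordinal_trans.
Qed.

Lemma limit_naturals (m g d : M) : natural m -> ordinal g -> bigcup_F_eq m g ->
  ordinal d -> d ∈ g -> forall i, natural i -> i ∈ g.
Proof using hM ext.
  intros Nm Og Lg Od Hd; natural_induction.
  - destruct (zero_least Od) as [->|H]; eauto using ordinal_trans.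
  - intros i Ni Hi; apply (limit_succ Nm); auto using natural_ordinal.
Qed.

(* The least ordinal above all d + ω^m·i would be a first ω^m-number strictly
   between d and g if it were below g. *)
Lemma omega_next_of_step (m d g : M) : natural m -> ordinal d -> ordinal g -> d ∈ g ->
  bigcup_F_eq m d -> (forall u, u ∈ g -> d ∈ u -> ~ bigcup_F_eq m u) ->
  (forall i x, natural i -> is_omega_mul m d i x ->
     x ∈ g -> ordinal x -> F_member m x ->
     exists y, is_omega_mul m d (succ i) y /\
       (y ∈ g /\ ordinal y /\ F_member m y) /\ x ∈ y) ->
  omega_next m d g.
Proof using hM ext.
  intros Nm Od Og Hd Ld between step.
  pose proof (bigcup_F_eq_member Nm Ld) as Fd.
  pose proof (is_omega_mul_zero Nm Od Fd) as H0.
  assert (E : forall i, natural i -> exists x, is_omega_mul m d i x /\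
    x ∈ g /\ ordinal x /\ F_member m x).
  { natural_induction; [exists d; auto|].
    intros i Ni [x [Hx [Hg [Ox Fx]]]]. destruct (step i x) as [y [Hy [Ky _]]]; eauto. }
  assert (R : forall i x, natural i -> is_omega_mul m d i x ->
    x ∈ g /\ ordinal x /\ F_member m x).
  (* By uniqueness, the properties of the constructed terms hold for every value of the term. *)
  { intros i x Ni Hx; destruct (E i Ni) as [x' [Hx' K]].
    now rewrite (is_omega_mul_unique Hx Hx'). }
  split; [intros i Ni; destruct (E i Ni) as [x [Hx _]]; eauto|].
  intros u; split.
  2:{ intros [i [x [Ni [Hx Hu]]]]; destruct (R i x Ni Hx) as [Hg _].
      apply (ordinal_trans Og Hg Hu). }
  intros Hu; apply NNPP; intros N.
  assert (Ou : ordinal u).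
  { destruct (ordinal_mem_cases Og Hu) as [Z|]; auto. exfalso; apply N.
    exists zero, d; auto using natural_zero, zero_subset. }
  assert (U : forall i x, natural i -> is_omega_mul m d i x -> x ∈ u \/ x = u).
  { intros i x Ni Hx; destruct (R i x Ni Hx) as [_ [Ox _]].
    destruct (ordinal_trichotomy Ox Ou) as [H|[H|H]]; auto. exfalso; eauto 6. }
  destruct (@ordinal_least (fun w => forall i x, natural i -> is_omega_mul m d i x ->
    x ∈ w \/ x = w) u) as [w [Ow [Hw [Uw Lw]]]]; [definable_tac|auto..|].
  assert (Hwg : w ∈ g) by (destruct Hw as [->|Hw]; eauto using ordinal_trans).
  (* So far a term may equal [w]; as each term lies below the next one, all are strictly below. *)
  assert (below : forall i x, natural i -> is_omega_mul m d i x -> x ∈ w).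
  { intros i x Ni Hx; destruct (R i x Ni Hx) as [Hg [Ox Fx]].
    destruct (step i x Ni Hx Hg Ox Fx) as [y [Hy [_ Hxy]]].
    destruct (Uw (succ i) y (natural_succ Ni) Hy) as [H|<-]; eauto using ordinal_trans. }
  pose proof (below zero d natural_zero H0) as Hdw.
  apply (between w Hwg Hdw), bigcup_F_eqE; auto.
  intros v Hv; destruct (ordinal_mem_cases Ow Hv) as [Z|Ov].
  - exists d; auto using zero_subset.
  (* By minimality of [w], the ordinal v is not an upper bound, so some term exceeds it. *)
  - apply NNPP; intros C; apply (Lw v Hv Ov); intros i x Ni Hx.
    destruct (R i x Ni Hx) as [_ [Ox Fx]].
    destruct (ordinal_trichotomy Ox Ov) as [H|[H|H]]; auto.
    exfalso; apply C; exists x; eauto.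
Qed.

(** For m = 0 the next term after x is x + 1, still below the limit [g]. At level m + 1 it is the
    least first ω^m-number above x, which the induction hypothesis identifies as x + ω^{m+1}. *)
Lemma omega_next_between (m : M) : natural m -> forall d g,
  ordinal d -> ordinal g -> d ∈ g -> bigcup_F_eq m d -> bigcup_F_eq m g ->
  (forall u, u ∈ g -> d ∈ u -> ~ bigcup_F_eq m u) -> omega_next m d g.
Proof using hM ext.
  revert m; natural_induction.
  - intros d g Od Og Hd Ld Lg between.
    apply omega_next_of_step; auto using natural_zero.
    intros i x Ni Hx Hg Ox _; exists (succ x).
    split; [now apply is_omega_mul_zero_succ|].
    rewrite in_succ; split; [|auto]. split; [|auto using F_member_zero, ordinal_succ].
    now apply (limit_succ natural_zero).
  - intros m Nm IH d g Od Og Hd Ld Lg between.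
    apply omega_next_of_step; auto using natural_succ.
    intros i x Ni Hx Hg Ox Fx; apply F_member_succ in Fx; auto.
    (* As [g] is a first ω^{m+1}-number, some first ω^m-number below [g] lies above x; the least
       such is taken. *)
    destruct (proj1 (bigcup_F_eqE (natural_succ Nm) (or_introl Og)) Lg x Hg)
      as [v [Hv [Fv Kv]]]; apply F_member_succ in Fv; auto.
    pose proof (ordinal_of_mem Og Hv Kv Ox) as Ov.
    destruct (@ordinal_least (fun w => x ∈ w /\ bigcup_F_eq m w) v)
      as [w [Ow [Hw [[Kw Fw] Lw]]]]; [definable_tac|auto..|].
    assert (Hwg : w ∈ g) by (destruct Hw as [->|Hw]; eauto using ordinal_trans).
    exists w; split; [|split; [split; [auto|split; [auto|now apply F_member_succ]]|auto]].
    apply (is_omega_mul_succ (W := g) (z := x)); auto.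
    + now apply (limit_naturals (natural_succ Nm) Og Lg Od).
    + apply IH; auto. intros u Hu Ku Lu.
      apply (Lw u Hu); [now apply (ordinal_of_mem Ow Hu Ku)|auto].
Qed.

Lemma omega_decomposition (m : M) : natural m -> forall g, ordinal g ->
  bigcup_F_eq m g -> exists a n, ordinal a /\ natural n /\
    bigcup_F_eq (succ m) a /\ is_omega_mul (succ m) a n g.
Proof using hM ext.
  intros Nm.
  (* The successor of [m] is named by a parameter [s], so that the induction predicate speaks of
     variables and parameters only. *)
  enough (K : forall s, is_succ m s -> forall g, ordinal g ->
    bigcup_F_eq m g -> exists a n, ordinal a /\ natural n /\
    bigcup_F_eq s a /\ is_omega_mul s a n g) by (now apply K, is_succE).
  intros s Hs. assert (Ns : natural s) by (apply is_succE in Hs as ->; now apply natural_succ).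
  ordinal_induction; intros g Og IH Lg. apply is_succE in Hs as ->.
  destruct (classic (bigcup_F_eq (succ m) g)) as [L|L].
  { exists g, zero. split; [auto|split; [apply natural_zero|split; [auto|]]].
    apply is_omega_mul_zero; auto. now apply F_member_succ. }
  (* Failure at level m + 1 yields a member of [g] that no first ω^m-number below [g] contains,
     hence a bound for these numbers. *)
  assert (E : exists w, w ∈ g /\ forall v, v ∈ g -> bigcup_F_eq m v -> w ∉ v).
  { apply NNPP; intros N; apply L, bigcup_F_eqE; auto.
    intros w Hw; apply NNPP; intros C; apply N; exists w; split; auto.
    intros v Hv Lv Kv; apply C; exists v; rewrite F_member_succ; auto. }
  destruct E as [w [Hw Bw]].
  (* An individual would belong to 0, which is a first ω^m-number for every m. *)
  assert (Ow : ordinal w).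
  { destruct (ordinal_mem_cases Og Hw) as [Z|]; auto. exfalso.
    destruct (zero_least Og) as [->|H].
    - apply L, bigcup_F_eq_zero; auto.
    - apply (Bw zero H); auto using bigcup_F_eq_zero. }
  destruct (@ordinal_least (fun w => forall v, v ∈ g -> ordinal v -> bigcup_F_eq m v ->
    v ∈ w \/ v = w) w) as [d [Od [Hd [Ud Ld]]]]; [definable_tac|auto| |].
  { intros v Hv Ov Lv; destruct (ordinal_trichotomy Ov Ow) as [H|[H|H]]; auto.
    exfalso; now apply (Bw v). }
  assert (Hdg : d ∈ g) by (destruct Hd as [->|Hd]; eauto using ordinal_trans).
  (* Every ordinal below the least bound [d] is exceeded by some first ω^m-number v that is at most
     [d]. Either v is [d], and the claim holds, or all such v are members of [d] and exhaust it. *)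
  assert (Fd : bigcup_F_eq m d).
  { apply NNPP; intros N; apply N, bigcup_F_eqE; auto.
    intros u Hu; destruct (ordinal_mem_cases Od Hu) as [Z|Ou].
    - exists u; auto using zero_individual, F_member_individual.
    - apply NNPP; intros C; apply (Ld u Hu Ou); intros v Hv Ov Lv.
      destruct (ordinal_trichotomy Ov Ou) as [H|[H|H]]; auto.
      exfalso; apply C; exists v.
      destruct (Ud v Hv Ov Lv) as [K| ->]; [|tauto].
      auto using bigcup_F_eq_member. }
  destruct (IH d Hdg Od Fd) as [a [n [Oa [Nn [La Ha]]]]].
  exists a, (succ n). split; [auto|split; [now apply natural_succ|split; [auto|]]].
  apply (is_omega_mul_succ (W := g) (z := d)); auto.
  - now apply (limit_naturals Nm Og Lg Od).
  - apply omega_next_between; auto. intros u Hu Ku Lu.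
    pose proof (ordinal_of_mem Og Hu Ku Od) as Ou.
    destruct (Ud u Hu Ou Lu) as [H| ->].
    + apply (ordinal_irrefl Od), (ordinal_trans Od H Ku).
    + now apply (ordinal_irrefl Od).
Qed.

End Extensional.

(** * Return to an arbitrary model *)

Unset Implicit Arguments.

Theorem theorem13 (M : structure) (hM : is_model M) (g m : M)
  (hg : ordinal g) (hm : natural m) (h : bigcup_F_eq m g) :
  exists a n m1 : M,
    ordinal a /\ natural n /\ is_succ m m1 /\
    bigcup_F_eq m1 a /\ is_omega_mul m1 a n g.
Proof.
  pose proof (canon_surj (M := M)) as surj.
  pose proof (canon_mem hM) as cmem.
  pose proof (is_model_transfer surj cmem eq_refl eq_refl hM) as hN.
  apply (ordinal_transfer surj cmem eq_refl eq_refl) in hg.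
  apply (natural_transfer surj cmem eq_refl eq_refl) in hm.
  apply (bigcup_F_eq_transfer surj cmem eq_refl eq_refl) in h.
  destruct (omega_decomposition hN (@reprs_ext M hM) hm hg h)
    as [a' [n' [Ha [Hn [La Hg]]]]].
  destruct (surj a') as [a <-], (surj n') as [n <-].
  (* The successor is formed among the representatives and then pulled back to a set of [M]. *)
  destruct (surj (succ (canon m : reprs M))) as [m1 Hm1].
  rewrite <- Hm1 in La, Hg.
  exists a, n, m1.
  split; [now apply (ordinal_transfer surj cmem eq_refl eq_refl)|].
  split; [now apply (natural_transfer surj cmem eq_refl eq_refl)|].
  split; [|split].
  - apply (is_succ_transfer surj cmem).
    now apply (is_succE hN (@reprs_ext M hM)).
  - now apply (bigcup_F_eq_transfer surj cmem eq_refl eq_refl).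
  - now apply (is_omega_mul_transfer surj cmem eq_refl eq_refl).
Qed.
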